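(* Let $G$ be a connected graph and let $m=\mathrm{ml}(G)$. Then $\mathcal{P}^{m+3}(G)$ has the Pairing-Hamiltonian property.
   Context: All graphs are finite and simple. For a connected graph $G$, the minimum leaf number $\mathrm{ml}(G)$ is the minimum number of leaves over all spanning trees of $G$. For a graph $G$, let $K_G$ denote the complete graph on the vertex set $V(G)$. If $G$ has even order, a perfect matching of $K_G$ is called a pairing of $G$. A graph $G$ of even order has the Pairing-Hamiltonian property if for every pairing $M$ of $G$ there exists a perfect matching $N$ of $G$ (using only edges of $G$) such that $M\cup N$ is the edge set of a Hamiltonian cycle of $K_G$. The prism graph $\mathcal{P}(G)$ is the Cartesian product $G\,\Box\,K_2$, i.e. two copies of $G$ with an edge joining each vertex to its copy. Define $\mathcal{P}^0(G)=G$ and $\mathcal{P}^k(G)=\mathcal{P}(\mathcal{P}^{k-1}(G))$ for $k\geq 1$. *)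

(* Defs.v *)
From HB Require Import structures.
From mathcomp Require Import all_boot.

Set Implicit Arguments.
Unset Strict Implicit.
Unset Printing Implicit Defensive.

Record sgraph := SGraph {
  vertex :> finType;
  adj : rel vertex;
  adj_sym : symmetric adj;
  adj_irrefl : irreflexive adj
}.

Definition edges (G : sgraph) : {set {set G}} :=
  [set [set p.1; p.2] | p : G * G & adj p.1 p.2].

Lemma complete_sym (T : finType) : symmetric (fun x y : T => x != y).
Proof. by move=> x y; rewrite eq_sym. Qed.

Lemma complete_irrefl (T : finType) : irreflexive (fun x y : T => x != y).
Proof. by move=> x; rewrite eqxx. Qed.

Definition complete (T : finType) : sgraph :=
  SGraph (@complete_sym T) (@complete_irrefl T).

Definition box_rel (G H : sgraph) : rel (G * H) := fun p q =>
  (p.1 == q.1) && adj p.2 q.2 || adj p.1 q.1 && (p.2 == q.2).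

Lemma box_sym (G H : sgraph) : symmetric (@box_rel G H).
Proof.
by move=> p q; rewrite /box_rel !(adj_sym q.1, adj_sym q.2) !(eq_sym q.1, eq_sym q.2).
Qed.

Lemma box_irrefl (G H : sgraph) : irreflexive (@box_rel G H).
Proof. by move=> p; rewrite /box_rel !adj_irrefl andbF. Qed.

Definition box (G H : sgraph) : sgraph :=
  SGraph (@box_sym G H) (@box_irrefl G H).

Definition prism (G : sgraph) : sgraph := box G (complete bool).

(* The spanning subgraph of [complete T] whose edges are the two-element
   members of S. *)
Definition edge_rel (T : finType) (S : {set {set T}}) : rel T :=
  fun x y => (x != y) && ([set x; y] \in S).

Lemma edge_rel_sym (T : finType) (S : {set {set T}}) : symmetric (edge_rel S).
Proof. by move=> x y; rewrite /edge_rel eq_sym setUC. Qed.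

Lemma edge_rel_irrefl (T : finType) (S : {set {set T}}) :
  irreflexive (edge_rel S).
Proof. by move=> x; rewrite /edge_rel eqxx. Qed.

Definition edge_graph (T : finType) (S : {set {set T}}) : sgraph :=
  SGraph (edge_rel_sym S) (edge_rel_irrefl S).

Definition connected (G : sgraph) : bool :=
  (0 < #|G|) && [forall x : G, forall y : G, connect (@adj G) x y].

(* A cycle visits at most #|G| vertices, which makes acyclicity a finite check;
   see [acyclicP]. *)
Definition acyclic (G : sgraph) : bool :=
  [forall n : 'I_#|G|.+1, forall c : n.-tuple G,
     (2 < n) ==> ~~ ucycleb (@adj G) c].

Lemma acyclicP (G : sgraph) :
  reflect (forall c : seq G, 2 < size c -> ~ ucycle (@adj G) c) (acyclic G).
Proof.
apply: (iffP forallP) => [H c c_gt2 Hc | H n].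
  have sz : size c < #|G|.+1.
    by case/andP: Hc => _ /card_uniqP <-; apply: max_card.
  have /forallP/(_ (in_tuple c)) := H (Ordinal sz).
  by rewrite c_gt2 /= => /negP; apply.
apply/forallP => c; apply/implyP => n_gt2; apply/negP.
by apply: H; rewrite size_tuple.
Qed.

Definition tree (G : sgraph) : bool := connected G && acyclic G.

Definition spanning_tree (G : sgraph) (S : {set {set G}}) : bool :=
  (S \subset edges G) && tree (edge_graph S).

Definition leaves (G : sgraph) : {set G} :=
  [set x | #|[set y | adj x y]| == 1].

(* The default #|G| bounds every leaf count, so it does not affect the minimum
   as soon as G has a spanning tree; see [ml_le] and [ml_attained]. *)
Definition ml (G : sgraph) : nat :=
  \big[minn/#|G|]_(S : {set {set G}} | spanning_tree S) #|leaves (edge_graph S)|.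

Lemma ml_le (G : sgraph) (S : {set {set G}}) :
  spanning_tree S -> ml G <= #|leaves (edge_graph S)|.
Proof.
move=> HS; rewrite /ml; have := mem_index_enum S.
elim: (index_enum _) => // A r IHr; rewrite inE big_cons => /predU1P[<- | /IHr le_r].
  by rewrite HS geq_minl.
by case: ifP => // _; apply: leq_trans le_r; apply: geq_minr.
Qed.

Lemma ml_attained (G : sgraph) (S : {set {set G}}) : spanning_tree S ->
  exists2 S' : {set {set G}}, spanning_tree S' & ml G = #|leaves (edge_graph S')|.
Proof.
move=> HS.
case: (arg_minnP (fun A : {set {set G}} => #|leaves (edge_graph A)|) HS) => A HA minA.
exists A => //; apply/eqP; rewrite eqn_leq ml_le //= /ml.
apply: (big_ind (fun n => #|leaves (edge_graph A)| <= n)) => //.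
- exact: max_card.
- by move=> x y; rewrite leq_min => -> ->.
Qed.

Definition perfect_matching (G : sgraph) (N : {set {set G}}) : bool :=
  [&& N \subset edges G, trivIset N & cover N == [set: G]].

Definition pairing (G : sgraph) (M : {set {set G}}) : bool :=
  @perfect_matching (complete G) M.

Definition hamiltonian_cycle (G : sgraph) (c : seq G) : Prop :=
  [/\ 2 < size c, ucycle (@adj G) c & forall x : G, x \in c].

Definition cycle_edges (T : finType) (c : seq T) : {set {set T}} :=
  [set [set x; next c x] | x in c].

Definition pairing_hamiltonian (G : sgraph) : Prop :=
  ~~ odd #|G| /\
  forall M : {set {set G}}, pairing M ->
    exists2 N : {set {set G}}, perfect_matching N &
      exists2 c : seq G,
        @hamiltonian_cycle (complete G) c & cycle_edges c = M :|: N.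

(* Main.v *)
Require Import Defs.
From mathcomp Require Import all_boot.

(* Pairings M and matchings N are handled as fixed-point-free involutions m and
   n; M :|: N is a Hamiltonian cycle as soon as the graph linking x to m x and
   n x is connected, which turns all cycle surgery into connectivity arguments.

   If two disjoint vertex sets have the property and M crosses between them,
   then so does their union (Fink).  Hence in a product of a path with the cube
   Q_3 only pairings that preserve every layer matter.  Those are treated by a
   finite transfer argument along the path: a state records which vertices of
   the current layer still wait for an edge to the next layer, and how the paths
   built so far connect them; seven sets of states, up to automorphisms of Q_3,
   are closed under every one of the 105 pairings of the next layer.

   Finally, a spanning tree with m leaves is exhausted by starting at a vertex
   and repeatedly attaching a maximal path, which ends at a new leaf.  Each
   attached path costs one prism to keep a Hamiltonian path, so the m-th prism
   is traceable and the (m+3)-rd one contains a spanning product of a path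
   with Q_3. *)

Set Implicit Arguments.
Unset Strict Implicit.
Unset Printing Implicit Defensive.

(** * Pairings and gluing *)

Section Pairings.
Variable T : finType.
Implicit Types (A B S : {set T}) (m n : T -> T) (g : rel T).

Definition pairing_on S m :=
  forall x, x \in S -> [/\ m x \in S, m (m x) = x & m x != x].

Lemma pairing_on_even S m : pairing_on S m -> ~~ odd #|S|.
Proof.
have [k] := ubnP #|S|; elim: k S => // k IHk S leSk mS.
have [->|[x Sx]] := set_0Vmem S; first by rewrite cards0.
have [Smx mmx mx_neq] := mS x Sx.
have Smx' : m x \in S :\ x by rewrite !inE mx_neq.
have cardS : #|S| = #|S :\ x :\ m x|.+2.
  by rewrite (cardsD1 x) Sx (cardsD1 (m x)) Smx'.
rewrite cardS /= negbK; apply: IHk.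
  by move: leSk; rewrite cardS ltnS; apply: ltn_trans.
move=> y; rewrite !inE => /and3P[y_neq1 y_neq2 Sy].
have [Smy mmy my_neq] := mS y Sy; split=> //.
rewrite Smy andbT; apply/andP; split; apply/eqP => eq_my.
  by case/eqP: y_neq2; rewrite -mmy eq_my mmx.
by case/eqP: y_neq1; rewrite -mmy eq_my.
Qed.

(** Two points of one fibre of [f] are paired and removed, which keeps every fibre even. A constant
    [f] gives any pairing, [root R] one inside the components of [R]. *)
Lemma even_pairing (K : eqType) (f : T -> K) S :
    (forall x, x \in S -> ~~ odd #|[set y in S | f y == f x]|) ->
  exists2 m, pairing_on S m & {in S, forall x, f (m x) = f x}.
Proof.
have [k] := ubnP #|S|; elim: k S => // k IHk S leSk evS.
have [->|[x Sx]] := set_0Vmem S; first by exists id => x; rewrite inE.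
have := evS x Sx; rewrite (cardsD1 x) !inE Sx eqxx /= negbK.
case: (set_0Vmem ([set y in S | f y == f x] :\ x)) => [->|[y]].
  by rewrite cards0.
rewrite !inE => /and3P[y_neq Sy /eqP fy] _.
have Sy' : y \in S :\ x by rewrite !inE y_neq.
have cardS : #|S| = #|S :\ x :\ y|.+2.
  by rewrite (cardsD1 x) Sx (cardsD1 y) Sy'.
have [||m mS fm] := IHk (S :\ x :\ y).
- by move: leSk; rewrite cardS ltnS; apply: ltn_trans.
- move=> z; rewrite !inE => /and3P[zy zx Sz].
  have [fzx|fzx] := eqVneq (f z) (f x); last first.
    rewrite (_ : [set _ in _ | _] = [set t in S | f t == f z]) ?evS //.
    apply/setP => t; rewrite !inE; have [->|_] := eqVneq t x.
      by rewrite [f x == _]eq_sym (negPf fzx) !andbF.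
    have [->|_] /= := eqVneq t y; last by [].
    by rewrite fy [f x == _]eq_sym (negPf fzx) andbF.
  have := evS z Sz; rewrite (cardsD1 x) !inE Sx fzx eqxx /=.
  rewrite (cardsD1 y) !inE y_neq Sy fy eqxx /= negbK.
  rewrite (_ : _ :\ _ :\ _ = [set t in S :\ x :\ y | f t == f x]) //.
  by apply/setP => t; rewrite !inE !andbA.
exists (fun z => if z == x then y else if z == y then x else m z).
  move=> z Sz; have [->|zx] := eqVneq z x.
    by rewrite eqxx (negPf y_neq); split.
  have [->|zy] := eqVneq z y.
    by rewrite eqxx; split=> //; rewrite eq_sym.
  have /mS[] : z \in S :\ x :\ y by rewrite !inE zx zy.
  by rewrite !inE => /and3P[/negPf-> /negPf-> ->].
move=> z Sz /=; have [->|zx] := eqVneq z x => //.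
have [->|zy] := eqVneq z y => //.
by rewrite fm // !inE zx zy.
Qed.

(* [m] and [n] need only be meaningful on [A] and [B] respectively. *)
Definition link A m B n : rel T :=
  fun x y => (x \in A) && (y == m x) || (x \in B) && (y == n x).

Lemma link_sym A m B n : pairing_on A m -> pairing_on B n ->
  symmetric (link A m B n).
Proof.
move=> mA nB.
have imp x y : link A m B n x y -> link A m B n y x.
  case/orP=> /andP[Xx /eqP->]; apply/orP; [left|right].
    by have [-> -> _] := mA x Xx; rewrite eqxx.
  by have [-> -> _] := nB x Xx; rewrite eqxx.
by move=> x y; apply/idP/idP; apply: imp.
Qed.

Lemma connect_invariant (r : rel T) (P : pred T) x y :
  (forall u v, r u v -> P u -> P v) -> connect r x y -> P x -> P y.
Proof.
move=> inv_r /connectP[p]; elim: p x => [|z p IHp] x /=; first by move=> _ ->.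
by case/andP=> xz zp eq_y Px; apply: (IHp z) => //; apply: inv_r xz Px.
Qed.

(** A set closed under all links is a union of components, so both pairings restrict to it; by
    parity, the part of [C] outside [A] has even size. *)
Lemma pairing_component A m B n (C : {set T}) :
    pairing_on A m -> pairing_on B n -> C \subset B ->
    (forall u v, link A m B n u v -> u \in C -> v \in C) ->
  pairing_on (C :&: A) m /\ pairing_on C n.
Proof.
move=> mA nB sCB linkC; split=> x.
  case/setIP=> Cx Ax; have [Amx mmx mx_neq] := mA x Ax; split=> //.
  by rewrite inE Amx (linkC x) // /link Ax eqxx.
move=> Cx; have Bx := subsetP sCB x Cx; have [Bnx nnx nx_neq] := nB x Bx.
by split=> //; apply: (linkC x) => //; rewrite /link Bx eqxx orbT.
Qed.

(** Each point of [S] has one partner under each pairing, so [m] and [n] cut [S] into alternating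
    cycles, and connectedness leaves only one. A two-point [S] passes too, as a doubled edge. *)
Definition good g S m n :=
  [/\ pairing_on S n, {in S, forall x, g x (n x)}
    & {in S &, forall x y, connect (link S m S n) x y}].

Definition hamiltonian_on g S :=
  ~~ odd #|S| /\ forall m, pairing_on S m -> exists n, good g S m n.

(* Fink's gluing: pair the ends of the crossing edges in [S1] arbitrarily to
   get [n1]; the components of [m] and [n1] on [S1] contain an even number of
   such ends, which are paired within components to get [n2]. *)
Lemma hamiltonian_glue g S1 S2 m x0 :
    [disjoint S1 & S2] -> hamiltonian_on g S1 -> hamiltonian_on g S2 ->
    pairing_on (S1 :|: S2) m -> x0 \in S1 -> m x0 \in S2 ->
  exists n, good g (S1 :|: S2) m n.
Proof.
move=> dis12 [ev1 ham1] [_ ham2] mS S1x0 S2mx0.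
have in1 x : x \in S1 -> x \in S1 :|: S2 by rewrite inE => ->.
have in2 x : x \in S2 -> x \in S1 :|: S2 by rewrite inE orbC => ->.
have not12 x : x \in S1 -> (x \in S2) = false := disjointFr dis12.
have not21 x : x \in S2 -> (x \in S1) = false := disjointFl dis12.
pose E := [set x in S1 | m x \in S2].
have mD : pairing_on (S1 :\: E) m.
  move=> x; rewrite !inE negb_and => /andP[/orP[/negPf->//|S2mx] S1x].
  have [] := mS x (in1 x S1x); rewrite inE (negPf S2mx) orbF => S1mx mmx mx_neq.
  by split=> //; rewrite S1mx mmx (not12 x).
have sE1 : E \subset S1 by apply/subsetP=> x; rewrite inE => /andP[].
have [A mA _] : exists2 A, pairing_on E A & {in E, forall x, tt = tt}.
  apply: (even_pairing (f := fun=> tt)) => x _.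
  have := ev1; rewrite -(cardsID E S1) oddD (negPf (pairing_on_even mD)) addbF.
  rewrite (setIidPr sE1) (_ : [set y in E | _] = E) //.
  by apply/setP=> y; rewrite inE eqxx andbT.
pose m1 x := if x \in E then A x else m x.
have m1S : pairing_on S1 m1.
  move=> x S1x; rewrite /m1; have [Ex|Ex] := boolP (x \in E).
    by have [EAx -> ->] := mA x Ex; rewrite EAx (subsetP sE1).
  have /mD[] : x \in S1 :\: E by rewrite inE Ex.
  by rewrite inE => /andP[/negPf-> ->].
have [n1 [n1S n1g n1c]] := ham1 m1 m1S.
(* Without the artificial pairs of [A], the cycle in [S1] falls apart into paths whose ends are the
   points of [E]; [b] matches the ends of each path. *)
pose R := link (S1 :\: E) m S1 n1.
have symR : connect_sym R by apply/sym_connect_sym/link_sym.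
have R1 x y : R x y -> x \in S1 -> y \in S1.
  case/orP=> /andP[X1 /eqP->] _; first by have [] := mD x X1; rewrite inE => /andP[].
  by have [] := n1S x X1.
have [b bE bR] : exists2 b, pairing_on E b & {in E, forall x, root R (b x) = root R x}.
  apply: (even_pairing (f := root R)) => x Ex.
  pose C := [set y in S1 | connect R x y].
  have [||mC nC] := @pairing_component _ _ _ _ C mD n1S.
  - by apply/subsetP=> y; rewrite inE => /andP[].
  - move=> u v Ruv; rewrite !inE => /andP[S1u xu]; rewrite (R1 u v) //=.
    exact: connect_trans xu (connect1 Ruv).
  have := pairing_on_even nC.
  rewrite -(cardsID (S1 :\: E) C) oddD (negPf (pairing_on_even mC)) /=.
  rewrite (_ : C :\: _ = [set y in E | root R y == root R x]) //.
  apply/setP=> y; rewrite !inE -(root_connect symR) [root R x == _]eq_sym.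
  by case: (y \in S1); case: (m y \in S2); rewrite ?andbF.
have mE x : x \in E -> m x \in S2 by rewrite inE => /andP[].
have S2E y : y \in S2 -> m y \notin S2 -> m y \in E.
  move=> S2y; have [] := mS y (in2 y S2y); rewrite !inE => + mmy _.
  by case/orP=> -> //; rewrite mmy S2y.
(* A crossing edge at [y] continues along a path through [S1] and returns over the crossing edge at
   its other end; [m2] contracts this excursion to one pair. *)
pose m2 y := if m y \in S2 then m y else m (b (m y)).
have m2S : pairing_on S2 m2.
  move=> y S2y; rewrite /m2; have [_ mmy my_neq] := mS y (in2 y S2y).
  case: ifPn => [S2my | /(S2E y S2y) Emy]; first by rewrite mmy S2y.
  have [Ebmy bbmy bmy_neq] := bE _ Emy.
  have S1bmy := subsetP sE1 _ Ebmy.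
  have [_ mmb _] := mS _ (in1 _ S1bmy).
  rewrite (mE _ Ebmy) mmb not12 // bbmy mmy; split=> //.
  by apply: contraNneq bmy_neq => eq_y; rewrite -[in X in _ == X]eq_y mmb.
have [n2 [n2S n2g n2c]] := ham2 m2 m2S.
pose n x := if x \in S1 then n1 x else n2 x.
have nS : pairing_on (S1 :|: S2) n.
  move=> x; rewrite inE /n; case: ifPn => [S1x _ | _ /= S2x].
    by have [S1n -> ->] := n1S x S1x; rewrite inE S1n.
  by have [S2n -> ->] := n2S x S2x; rewrite inE (not21 _ S2n) S2n.
exists n; pose L := link (S1 :|: S2) m (S1 :|: S2) n.
have symL : connect_sym L by apply/sym_connect_sym/link_sym.
have Lm x : x \in S1 :|: S2 -> connect L x (m x).
  by move=> Sx; apply: connect1; rewrite /L /link Sx eqxx.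
have Ln x : x \in S1 :|: S2 -> connect L x (n x).
  by move=> Sx; apply: connect1; rewrite /L /link Sx eqxx orbT.
have RL : subrel (connect R) (connect L).
  apply: connect_sub => x y /orP[/andP[+ /eqP->] | /andP[S1x /eqP->]].
    by rewrite inE => /andP[_ S1x]; apply/Lm/in1.
  by have := Ln x (in1 x S1x); rewrite /n S1x.
(* A component of [R] without points of [E] would be closed under [m1] as well, hence be all of
   [S1]; yet [x0] lies in [E]. *)
have Lend x : x \in S1 -> exists2 e, e \in E & connect L x e.
  move=> S1x; apply/exists_inP; apply: contraT; rewrite negb_exists => /forallP noE.
  have /andP[_] : (x0 \in S1) && connect R x x0.
    have Ex0 : x0 \in E by rewrite inE S1x0.
    apply: (connect_invariant (P := fun y => (y \in S1) && connect R x y))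
      (n1c x x0 S1x S1x0) _; last by rewrite S1x connect0.
    move=> u v uv /andP[S1u xu].
    have nEu : u \notin E by have := noE u; rewrite negb_and (RL _ _ xu) orbF.
    have Ruv : R u v by move: uv; rewrite /R /link /m1 in_setD (negPf nEu).
    by rewrite (R1 u v) // (connect_trans xu (connect1 Ruv)).
  by move/RL => xx0; have := noE x0; rewrite inE S1x0 S2mx0 xx0.
have L2 : subrel (connect (link S2 m2 S2 n2)) (connect L).
  apply: connect_sub => y z /orP[] /andP[S2y /eqP->]; last first.
    by have := Ln y (in2 y S2y); rewrite /n not21.
  rewrite /m2; case: ifPn => [_ | /(S2E y S2y) Emy]; first exact/Lm/in2.
  apply: connect_trans (Lm y (in2 y S2y)) _.
  have [Ebmy _ _] := bE _ Emy.
  apply: connect_trans (Lm _ (in1 _ (subsetP sE1 _ Ebmy))).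
  by apply: RL; apply/(rootP symR); rewrite bR.
have L22 y z : y \in S2 -> z \in S2 -> connect L y z.
  by move=> S2y S2z; apply/L2/n2c.
have LS x : x \in S1 :|: S2 -> connect L x (m x0).
  rewrite inE => /orP[S1x | S2x]; last exact: L22.
  have [e Ee xe] := Lend x S1x; apply: connect_trans xe _.
  exact: connect_trans (Lm e (in1 e (subsetP sE1 e Ee))) (L22 _ _ (mE e Ee) S2mx0).
split=> //.
  move=> x; rewrite inE /n; case: ifPn => [S1x _ | _ /= S2x]; [exact: n1g | exact: n2g].
by move=> x y Sx Sy; apply: connect_trans (LS x Sx) _; rewrite symL LS.
Qed.

End Pairings.

(** * Transfer of path systems across a cube layer *)

Section EndLists.
Variable D : eqType.
Implicit Types (s l r : seq (D * D)) (p : D * D).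

Definition ends s : seq D := flatten [seq [:: p.1; p.2] | p <- s].

Lemma mem_ends s x : reflect (exists2 p, p \in s & x = p.1 \/ x = p.2) (x \in ends s).
Proof.
apply: (iffP flattenP) => [[_ /mapP[p sp ->]] | [p sp xp]].
  by rewrite !inE => /orP[]/eqP->; exists p; auto.
by exists [:: p.1; p.2]; [apply: map_f | case: xp => ->; rewrite !inE eqxx ?orbT].
Qed.

Fixpoint mate s x : D :=
  if s is p :: s' then
    if x == p.1 then p.2 else if x == p.2 then p.1 else mate s' x
  else x.

Lemma mate_mem s p : uniq (ends s) -> p \in s -> mate s p.1 = p.2 /\ mate s p.2 = p.1.
Proof.
elim: s => //= q s IHs; rewrite !inE negb_or.
case/and3P=> /andP[q_neq q1s] q2s us /predU1P[->|sp].
  by rewrite !eqxx eq_sym (negPf q_neq).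
have out x : (x == p.1) || (x == p.2) -> (x == q.1) = false /\ (x == q.2) = false.
  move=> xp; have sx : x \in ends s.
    by apply/mem_ends; exists p => //; case/orP: xp => /eqP; auto.
  by split; apply: contraTF sx => /eqP->.
have [-> ->] := out p.1 (introT orP (or_introl (eqxx _))).
have [-> ->] := out p.2 (introT orP (or_intror (eqxx _))).
exact: IHs.
Qed.

Lemma mateP s x : uniq (ends s) -> x \in ends s ->
  [/\ mate s x \in ends s, mate s (mate s x) = x, mate s x != x
    & (x, mate s x) \in s \/ (mate s x, x) \in s].
Proof.
move=> us /mem_ends[[y z] sp xp].
have [/= yz zy] := mate_mem us sp.
have y_neq : y != z.
  elim: s us sp {xp yz zy} => //= q s IHs; rewrite !inE negb_or.
  case/and3P=> /andP[q_neq _] _ us /predU1P[eq_q | /(IHs us)//].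
  by move: q_neq; rewrite -eq_q.
have sy : y \in ends s by apply/mem_ends; exists (y, z); auto.
have sz : z \in ends s by apply/mem_ends; exists (y, z); auto.
case: xp => /= ->; rewrite ?yz ?zy ?yz; split=> //; auto.
by rewrite eq_sym.
Qed.

(* A list of pairs lists the pairs of ends of a family of disjoint paths;
   merging along [p] concatenates the two paths that end in [p.1] and [p.2],
   and fails if these are one and the same path. *)
Fixpoint pick_end (x : D) s :=
  if s is p :: s' then
    if x == p.1 then Some (p.2, s') else
    if x == p.2 then Some (p.1, s') else
    if pick_end x s' is Some (y, r) then Some (y, p :: r) else None
  else None.

Definition merge_pair p s :=
  if pick_end p.1 s is Some (x, r) then
    if pick_end p.2 r is Some (y, r') then Some ((x, y) :: r') else None
  else None.

Fixpoint merge_paths l s :=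
  if l is p :: l' then if merge_pair p s is Some s' then merge_paths l' s' else None
  else Some s.

Definition pair_mem p s := (p \in s) || ((p.2, p.1) \in s).
Definition same_pairs r s := all (pair_mem^~ s) r && all (pair_mem^~ r) s.

Section Soundness.
Variable C : D -> D -> Prop.
Hypotheses (Crefl : forall x, C x x) (Csym : forall x y, C x y -> C y x).
Hypothesis Ctrans : forall x y z, C x y -> C y z -> C x z.

Definition joined s := forall p, p \in s -> C p.1 p.2.
Definition covering s := forall x, exists2 y, y \in ends s & C x y.

Lemma pick_end_joined x s y r : pick_end x s = Some (y, r) -> joined s ->
  [/\ C x y, joined r & forall z, z \in ends s -> C z x \/ z \in ends r].
Proof.
elim: s y r => //= p s IHs y r + js.
have js' : joined s by move=> q sq; apply: js; rewrite inE sq orbT.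
have jp : C p.1 p.2 by apply: js; rewrite inE eqxx.
have [-> [<- <-]|_] := eqVneq x p.1.
  by split=> // z; rewrite !inE => /or3P[/eqP->|/eqP->|]; auto.
have [-> [<- <-]|_] := eqVneq x p.2.
  by split=> //; [exact: Csym | move=> z; rewrite !inE => /or3P[/eqP->|/eqP->|]; auto].
case def_r: (pick_end x s) => [[y' r']|] // [<- <-].
have [xy jr endr] := IHs _ _ def_r js'; split=> // [q|z].
  by rewrite inE => /predU1P[->|/jr].
by rewrite !inE => /or3P[->|->|/endr[]]; rewrite ?orbT; auto => ->; rewrite !orbT; auto.
Qed.

(** Merging along [p] trades the ends [p.1] and [p.2] for the far ends of their paths, and what was
    tied to a lost end stays tied to a far one. No path is closed on itself, which would leave its
    points without an end. *)
Lemma merge_joined l s r : merge_paths l s = Some r -> joined l ->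
  joined s -> covering s -> joined r /\ covering r.
Proof.
elim: l s => [|p l IHl] s /=; first by move=> [<-].
case def_s: merge_pair => [s'|] // def_r jl js cs.
have jp : C p.1 p.2 by apply: jl; rewrite inE eqxx.
suffices [js' cs'] : joined s' /\ covering s'.
  by apply: IHl def_r _ js' cs' => q lq; apply: jl; rewrite inE lq orbT.
move: def_s; rewrite /merge_pair.
case def1: pick_end => [[x r1]|] //; case def2: pick_end => [[y r2]|] // [<-].
have [px jr1 end1] := pick_end_joined def1 js.
have [py jr2 end2] := pick_end_joined def2 jr1.
have xp2 : C x p.2 by apply: Ctrans jp; apply: Csym.
split=> [q|v].
  by rewrite inE => /predU1P[->|/jr2] //; apply: Ctrans xp2 _.
have [z sz vz] := cs v; have [zp|/end2[zp|r2z]] := end1 z sz.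
- exists x; first by rewrite !inE eqxx.
  by apply: Ctrans vz _; apply: Ctrans zp px.
- exists y; first by rewrite !inE eqxx orbT.
  by apply: Ctrans vz _; apply: Ctrans zp py.
by exists z; rewrite // !inE r2z !orbT.
Qed.

Lemma same_pairs_joined r s : same_pairs r s -> joined r -> covering r ->
  joined s /\ covering s.
Proof.
case/andP=> /allP rs /allP sr jr cr; split=> [p /sr/orP[/jr//|/jr/Csym//]|x].
have [y /mem_ends[p rp yp] xy] := cr x; exists y => //.
by apply/mem_ends; case/orP: (rs p rp) => sp; [exists p | exists (p.2, p.1)]; tauto.
Qed.

End Soundness.

(** [k] bounds the recursion, as [rem y t'] is not a subterm; [4] suffices for the eight vertices of
    the cube. *)
Fixpoint pairings (k : nat) (t : seq D) : seq (seq (D * D)) :=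
  match k, t with
  | _, [::] => [:: [::]]
  | k'.+1, x :: t' =>
      flatten [seq [seq (x, y) :: l | l <- pairings k' (rem y t')] | y <- t']
  | 0, _ => [::]
  end.

Lemma pairings_complete k (t : seq D) (f : D -> D) :
    size t <= k.*2 -> uniq t ->
    {in t, forall x, [/\ f x \in t, f (f x) = x & f x != x]} ->
  exists2 s, s \in pairings k t &
    (forall p, p \in s -> f p.1 = p.2) /\ ends s =i t.
Proof.
elim: k t => [|k IHk] [|x t] //= => [_ _ _|_ _ _|].
- by exists [::].
- by exists [::].
rewrite !ltnS => let_k /andP[tx ut] ft.
have [] := ft x (mem_head _ _); rewrite inE => /predU1P[->|tfx] ffx.
  by rewrite eqxx.
move=> fx_neq.
have [|||s s_in [fs ends_s]] := IHk (rem (f x) t).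
- by rewrite size_rem // -subn1 leq_subLR add1n.
- exact: rem_uniq.
- move=> y; rewrite !mem_rem_uniq // !inE => /andP[yfx ty].
  have [] := ft y; first by rewrite inE ty orbT.
  rewrite inE => /predU1P[fyx|tfy] ffy fy_neq.
    by rewrite -fyx ffy eqxx in yfx.
  split=> //; rewrite tfy andbT; apply: contraNneq tx => eq_f.
  by rewrite -ffx -eq_f ffy.
exists ((x, f x) :: s).
  apply/flattenP; exists [seq (x, f x) :: l | l <- pairings k (rem (f x) t)].
    exact: (map_f (fun y => [seq (x, y) :: l | l <- pairings k (rem y t)])).
  exact: map_f.
split=> [p|y]; first by rewrite inE => /predU1P[->|/fs].
rewrite !inE ends_s mem_rem_uniq // !inE.
by have [->|] := eqVneq y (f x); rewrite ?tfx ?orbT.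
Qed.

End EndLists.

Lemma all2_mem (A : eqType) (B : Type) (r : A -> B -> bool) (s : seq A) (t : seq B) x :
  all2 r s t -> x \in s -> exists y, r x y.
Proof.
elim: s t => //= z s IHs [|y t] //= /andP[rzy rst].
by rewrite inE => /predU1P[->|/(IHs t rst)//]; exists y.
Qed.

(** * The cube, its automorphisms and the certified transfer table *)

Definition cube := (bool * bool * bool)%type.

Definition cube_adj (u v : cube) : bool :=
  (u.1.1 != v.1.1) + (u.1.2 != v.1.2) + (u.2 != v.2) == 1.

Definition cube_enum : seq cube :=
  [seq (p, c) | p <- [seq (a, b) | a <- [:: false; true], b <- [:: false; true]],
                c <- [:: false; true]].

Lemma mem_cube_enum v : v \in cube_enum.
Proof. by move: v => [[[] []] []]. Qed.

(** All 48 automorphisms: a translation by [x], then one of the six permutations of the coordinates.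
    The order matters, since [certificate] refers to positions in this list. *)
Definition cube_syms : seq (cube -> cube) :=
  [seq (fun v : cube => s (v.1.1 (+) x.1.1, v.1.2 (+) x.1.2, v.2 (+) x.2))
  | s <- [:: (fun v : cube => v);
             (fun v : cube => (v.1.2, v.1.1, v.2));
             (fun v : cube => (v.1.1, v.2, v.1.2));
             (fun v : cube => (v.2, v.1.2, v.1.1));
             (fun v : cube => (v.1.2, v.2, v.1.1));
             (fun v : cube => (v.2, v.1.1, v.1.2))],
    x <- cube_enum].

Definition cube_automorphism (t : cube -> cube) :=
  injective t /\ forall u v, cube_adj (t u) (t v) = cube_adj u v.

Lemma cube_syms_nth k : cube_automorphism (nth id cube_syms k).
Proof.
have [k_lt|k_ge] := ltnP k (size cube_syms); last by rewrite nth_default //; split=> u v.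
have : all (fun t : cube -> cube =>
          all (fun u => all (fun v => ((t u == t v) == (u == v)) &&
            (cube_adj (t u) (t v) == cube_adj u v)) cube_enum) cube_enum) cube_syms.
  by vm_compute.
move/(all_nthP id)/(_ k k_lt)/allP => Ht.
split=> u v; last by have /allP/(_ v (mem_cube_enum v))/andP[_ /eqP] := Ht u (mem_cube_enum u).
by have /allP/(_ v (mem_cube_enum v))/andP[/eqP eq_t _] :=
  Ht u (mem_cube_enum u) => /eqP; rewrite eq_t => /eqP.
Qed.

Definition map_pairs (A B : Type) (f : A -> B) (s : seq (A * A)) :=
  [seq (f p.1, f p.2) | p <- s].

(* [P] lists the pairs of vertices of the layer joined through the layers below,
   [s] the paths obtained by merging the pairing of the layer along [P], and [P']
   the ends of the paths left open for the layers above; [N] is the part of the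
   matching that lies inside the layer. *)
Definition completes (P s P' : seq (cube * cube)) :=
  let used := ends P ++ ends P' in
  has (fun N => all (fun p => cube_adj p.1 p.2) N &&
                if merge_paths N s is Some r then
                  same_pairs r P' && uniq (ends P ++ ends N ++ ends P')
                  && (size (ends P ++ ends N ++ ends P') == 8)
                else false)
      (pairings 4 [seq v <- cube_enum | v \notin used]).

(* Seven families of states, found by a computer search; the vertices of the
   cube are numbered as in [cube_enum]. *)
Definition families : seq (seq (seq (cube * cube))) :=
  [seq [seq map_pairs (nth (false, false, false) cube_enum) P | P <- F] | F <- [::
   [:: [:: (0, 2)]; [:: (0, 4)]; [:: (1, 3)]; [:: (1, 5)]; [:: (4, 6)]; [::
       (0, 1); (3, 4)]; [:: (0, 7); (4, 5)]; [:: (1, 6); (4, 5)]];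
   [:: [:: (0, 2)]; [:: (2, 5)]; [:: (2, 6)]; [:: (6, 7)]; [:: (0, 7); (2,
       6)]];
   [:: [:: (0, 2)]; [:: (0, 7)]; [:: (2, 5)]; [:: (4, 5)]; [:: (0, 4); (5,
       7)]; [:: (1, 5); (2, 3)]];
   [:: [:: (0, 2)]; [:: (1, 3)]; [:: (2, 6)]; [:: (3, 4)]; [:: (3, 7)]; [::
       (0, 4); (2, 5)]; [:: (2, 5); (4, 6)]];
   [:: [:: (0, 2)]; [:: (0, 4)]; [:: (1, 3)]; [:: (2, 3)]; [:: (4, 5)]; [::
       (0, 2); (3, 4)]; [:: (1, 3); (2, 5)]; [:: (1, 6); (5, 7)]];
   [:: [:: (0, 4)]; [:: (1, 6)]; [:: (3, 4)]; [:: (6, 7)]; [:: (1, 3); (2,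
       6)]; [:: (1, 5); (4, 6)]];
   [:: [:: (1, 6)]; [:: (3, 4)]; [:: (4, 5)]; [:: (6, 7)]; [:: (1, 5); (4,
       6)]]]].

(* The first row is for the initial state. An entry [c], whose column stands for
   a pairing of the next layer, says that all states of family [c %/ 48], moved
   by symmetry [c %% 48], are then reachable. *)
Definition certificate : seq (seq nat) := [::
   [:: 0; 312; 8; 257; 56; 48; 257; 50; 192; 192; 49; 305; 50; 57; 0; 313;
       16; 32; 63; 241; 55; 198; 53; 289; 241; 57; 196; 61; 16; 59; 10; 34;
       264; 52; 50; 49; 54; 248; 49; 62; 49; 54; 48; 59; 53; 55; 48; 249;
       198; 288; 52; 304; 24; 24; 194; 249; 49; 51; 53; 40; 52; 48; 51; 62;
       54; 240; 2; 26; 256; 48; 54; 57; 61; 56; 51; 58; 49; 52; 18; 60; 58;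
       60; 50; 57; 50; 42; 52; 256; 240; 50; 48; 63; 54; 56; 240; 196; 48;
       56; 55; 194; 48; 248; 256; 48; 0];
   [:: 1; 309; 8; 2; 56; 48; 281; 50; 50; 50; 49; 305; 50; 57; 1; 313; 296;
       143; 101; 241; 55; 163; 114; 127; 313; 57; 55; 83; 105; 59; 10; 140;
       267; 53; 50; 49; 83; 243; 320; 68; 49; 55; 48; 50; 53; 3; 116; 246;
       53; 122; 112; 6; 42; 25; 68; 324; 49; 7; 53; 97; 53; 48; 51; 10; 57;
       240; 2; 27; 305; 48; 57; 57; 97; 56; 51; 51; 49; 104; 104; 53; 58; 8;
       50; 57; 6; 42; 108; 6; 72; 2; 48; 48; 55; 55; 312; 55; 48; 56; 55;
       48; 48; 320; 282; 6; 1];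
   [:: 135; 49; 123; 305; 51; 56; 51; 50; 70; 50; 49; 56; 50; 49; 125; 54;
       245; 293; 63; 56; 125; 61; 78; 82; 66; 49; 92; 51; 140; 54; 135; 138;
       49; 61; 50; 49; 305; 49; 49; 49; 49; 49; 51; 59; 56; 63; 63; 251; 75;
       123; 123; 63; 252; 29; 49; 251; 49; 29; 75; 97; 51; 51; 58; 54; 293;
       245; 305; 118; 56; 49; 92; 58; 51; 54; 51; 51; 49; 125; 245; 123;
       293; 49; 50; 49; 50; 96; 61; 73; 73; 50; 51; 63; 56; 245; 245; 245;
       49; 59; 56; 49; 56; 73; 49; 0; 0];
   [:: 129; 99; 121; 75; 51; 56; 51; 51; 71; 51; 31; 56; 51; 99; 135; 112;
       240; 32; 52; 17; 76; 88; 78; 78; 66; 49; 128; 51; 17; 54; 134; 136;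
       49; 59; 73; 49; 127; 49; 17; 49; 49; 49; 51; 71; 56; 60; 48; 51; 247;
       73; 73; 60; 118; 119; 48; 75; 49; 51; 59; 41; 51; 48; 78; 112; 121;
       240; 127; 31; 56; 48; 75; 17; 288; 51; 51; 51; 49; 299; 240; 247; 73;
       49; 59; 49; 60; 118; 73; 73; 73; 51; 51; 63; 56; 56; 295; 56; 49; 56;
       56; 49; 56; 73; 49; 49; 204];
   [:: 0; 48; 121; 259; 48; 4; 308; 50; 50; 51; 49; 57; 50; 49; 0; 55; 108;
       108; 55; 88; 125; 61; 77; 77; 69; 69; 318; 61; 109; 130; 10; 34; 48;
       60; 74; 49; 62; 69; 49; 62; 49; 49; 48; 50; 121; 63; 48; 48; 60; 86;
       74; 62; 98; 25; 48; 74; 49; 51; 60; 99; 60; 48; 77; 10; 121; 57; 130;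
       98; 57; 48; 57; 61; 48; 48; 51; 51; 49; 57; 108; 60; 55; 34; 50; 49;
       25; 98; 61; 1; 74; 50; 48; 48; 48; 48; 64; 325; 48; 60; 73; 48; 48;
       88; 48; 1; 0];
   [:: 10; 312; 121; 257; 56; 48; 58; 50; 51; 50; 49; 56; 50; 57; 129; 332;
       32; 32; 36; 265; 55; 66; 127; 289; 265; 57; 66; 66; 20; 59; 10; 136;
       266; 112; 50; 49; 66; 240; 49; 62; 49; 54; 48; 59; 56; 64; 63; 262;
       64; 288; 123; 308; 24; 24; 69; 93; 49; 51; 75; 44; 58; 48; 51; 112;
       54; 22; 2; 112; 56; 48; 54; 57; 97; 56; 51; 68; 49; 57; 22; 64; 73;
       96; 50; 57; 50; 46; 58; 309; 240; 50; 48; 63; 54; 56; 240; 54; 48;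
       22; 55; 49; 48; 94; 56; 48; 2];
   [:: 130; 48; 8; 72; 48; 79; 50; 50; 50; 50; 57; 57; 50; 50; 131; 53; 241;
       37; 55; 241; 79; 316; 114; 79; 246; 57; 57; 83; 105; 37; 130; 142;
       48; 50; 18; 50; 61; 50; 79; 68; 50; 57; 61; 50; 105; 302; 72; 48;
       133; 74; 74; 61; 116; 301; 243; 74; 57; 61; 74; 116; 58; 51; 51; 53;
       72; 18; 309; 116; 57; 57; 57; 57; 48; 48; 51; 58; 50; 57; 18; 50; 55;
       96; 50; 50; 50; 96; 58; 8; 72; 50; 51; 48; 48; 48; 64; 72; 48; 18;
       72; 70; 72; 72; 48; 8; 192];
   [:: 133; 164; 132; 72; 72; 297; 50; 50; 50; 50; 49; 57; 50; 50; 133; 163;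
       32; 32; 294; 241; 79; 246; 77; 77; 294; 244; 244; 246; 292; 292; 130;
       138; 48; 50; 18; 49; 61; 50; 46; 62; 49; 57; 48; 50; 142; 138; 19;
       48; 90; 74; 74; 61; 116; 117; 48; 74; 49; 61; 74; 116; 58; 48; 42;
       53; 72; 18; 329; 116; 57; 48; 57; 58; 48; 48; 51; 58; 49; 57; 18; 50;
       55; 116; 50; 50; 301; 42; 58; 74; 72; 50; 48; 48; 48; 48; 64; 72; 48;
       18; 72; 48; 48; 72; 48; 48; 32]].

(** A family collects states that are all attainable, each by its own matching. Given the pairing
    [q] of the next layer, every state of the new family must have a predecessor in [F], which may
    depend on that state. *)
Definition step_ok F q k :=
  let F1 := pmap (fun P => if merge_paths P q is Some s then Some (P, s) else None) F in
  let t := nth id cube_syms (k %% 48) in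
  (k %/ 48 < size families) &&
  all (fun P' => let P'' := map_pairs t P' in has (fun Ps => completes Ps.1 Ps.2 P'') F1)
    (nth [::] families (k %/ 48)).

(** The initial state and the seven families are run against all 105 pairings by evaluation; the
    columns follow the order of [pairings 4 cube_enum]. *)
Lemma certificate_ok :
  all2 (fun F => all2 (step_ok F) (pairings 4 cube_enum)) ([:: [::]] :: families) certificate.
Proof. by vm_compute. Qed.

(** Each family keeps a state with a single path whose ends are adjacent, so the process can stop
    after any layer by closing that path. *)
Lemma families_closable :
  all (has (fun P => if P is [:: (u, v)] then cube_adj u v else false)) families.
Proof. by vm_compute. Qed.

(** * Products of a path with the cube *)

Section CubeString.
Variables (T : finType) (g : rel T) (len : nat).
Variables (idx : T -> nat) (crd : T -> cube) (phi : nat -> cube -> T).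
Hypothesis phiK : forall x, phi (idx x) (crd x) = x.
Hypothesis idx_phi : forall i v, i < len -> idx (phi i v) = i.
Hypothesis crd_phi : forall i v, i < len -> crd (phi i v) = v.
Hypothesis g_sym : symmetric g.
Hypothesis g_layer : forall i u v, i < len -> cube_adj u v -> g (phi i u) (phi i v).
Hypothesis g_up : forall i v, i.+1 < len -> g (phi i v) (phi i.+1 v).

(** Layers below [len] are copies of the cube via [phi], with inverse [idx] and [crd]; [g] contains
    the edges of the product and may have more. *)
Definition segment a b := [set x | a <= idx x < b].

Lemma segment_even a b : b <= len -> ~~ odd #|segment a b|.
Proof.
move=> le_b; apply: (@pairing_on_even _ _ (fun x =>
  phi (idx x) (~~ (crd x).1.1, (crd x).1.2, (crd x).2))) => x.
rewrite inE => /andP[ax xb]; have lt_x := leq_trans xb le_b.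
rewrite inE idx_phi // crd_phi // ax xb negbK; split=> //.
  by rewrite -[RHS]phiK; case: (crd x) => [[] ].
apply/eqP=> /(congr1 (fun y => (crd y).1.1)); rewrite crd_phi //=.
by case: (crd x).1.1.
Qed.

(** * Pairings that preserve every layer *)

Section NonCrossing.
Variables (a b : nat) (m : T -> T).
Hypothesis le_b : b <= len.
Hypothesis m_pairing : pairing_on (segment a b) m.
Hypothesis m_idx : {in segment a b, forall x, idx (m x) = idx x}.

(* The layers below [k] are covered by paths of [m] and [n], all of whose ends
   lie in layer [k.-1] and are listed in [P]. *)
Definition reach k (P : seq (T * T)) := exists n,
  let B := segment a k :\: [set x in ends P] in
  let R := link (segment a k) m B n in
  [/\ {in ends P, forall x, a <= idx x /\ (idx x).+1 = k},
      pairing_on B n, {in B, forall x, g x (n x)},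
      {in segment a k, forall x, exists2 y, y \in ends P & connect R x y}
    & forall p, p \in P -> connect R p.1 p.2].

Lemma reach0 : reach a [::].
Proof.
have seg0 x : (x \in segment a a) = false by rewrite inE; case: leqP => // /leq_gtF.
by exists id; split=> // x; rewrite ?in_setD ?seg0 ?andbF.
Qed.

Lemma ends_map (A B : eqType) (f : A -> B) (P : seq (A * A)) :
  ends (map_pairs f P) = map f (ends P).
Proof. by rewrite /ends /map_pairs; elim: P => //= p P ->. Qed.

(** The ends in [P] are matched with the vertices above them, [N] acts inside layer [k], and the
    ends in [Q] stay open. The last premise ranges over all equivalence relations [C], so that it
    can be proved in the cube and then applied to connectedness under the new matching. *)
Lemma reach_step k P N Q (up := fun x => phi k (crd x)) :
    a <= k < b -> reach k P ->
    uniq (ends (map_pairs up P) ++ ends N ++ ends Q) ->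
    (forall x, (x \in ends (map_pairs up P) ++ ends N ++ ends Q) = (idx x == k)) ->
    (forall p, p \in N -> g p.1 p.2) ->
    (forall C : T -> T -> Prop,
      (forall x, C x x) -> (forall x y, C x y -> C y x) ->
      (forall x y z, C x y -> C y z -> C x z) ->
      (forall x, idx x = k -> C x (m x)) ->
      joined C (map_pairs up P) -> joined C N ->
      (forall x, idx x = k -> exists2 y, y \in ends Q & C x y) /\ joined C Q) ->
  reach k.+1 Q.
Proof.
move=> /andP[ak kb] [n [endP nB gB coverP joinP]] uniqL inL gN linkL.
set B := segment a k :\: _ in nB gB coverP joinP.
set R := link _ m B n in coverP joinP.
have k_len : k < len := leq_trans kb le_b.
have segS x : (x \in segment a k.+1) = (idx x == k) || (x \in segment a k).
  rewrite !inE ltnS (leq_eqVlt (idx x)).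
  by case: eqP => [->|_] //=; rewrite ak.
have below x : x \in segment a k -> (idx x == k) = false.
  by rewrite inE => /andP[_ /ltn_eqF].
move: uniqL; rewrite !cat_uniq has_cat negb_or.
case/and5P=> [_ /andP[/hasPn PN /hasPn PQ] uN /hasPn NQ _].
have kP x : x \in ends (map_pairs up P) -> idx x = k.
  by move=> Px; apply/eqP; rewrite -inL mem_cat Px.
have kN x : x \in ends N -> idx x = k.
  by move=> Nx; apply/eqP; rewrite -inL !mem_cat Nx !orbT.
have kQ x : x \in ends Q -> idx x = k.
  by move=> Qx; apply/eqP; rewrite -inL !mem_cat Qx !orbT.
have idx_up x : idx (up x) = k by rewrite /up idx_phi.
have upP x : x \in ends P -> up x \in ends (map_pairs up P).
  by move=> Px; rewrite ends_map map_f.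
have down_up x : x \in ends P -> phi k.-1 (crd (up x)) = x.
  by move=> /endP[_ <-]; rewrite /up crd_phi // phiK.
have Pdown x : x \in ends (map_pairs up P) -> phi k.-1 (crd x) \in ends P.
  by rewrite ends_map => /mapP[y Py ->]; rewrite down_up.
have up_down x : x \in ends (map_pairs up P) -> up (phi k.-1 (crd x)) = x.
  by rewrite ends_map => /mapP[y Py ->]; rewrite down_up.
have g_updown x : x \in ends P -> g x (up x).
  move=> Px; have [_ eq_k] := endP x Px; rewrite -{1}[x]phiK /up -eq_k.
  by apply: g_up; rewrite eq_k.
have segP x : x \in ends P -> x \in segment a k.
  by move=> /endP[ax eqk]; rewrite inE ax -eqk leqnn.
(* In order: open ends of layer [k.-1] go up, older vertices keep their partner, images of open ends
   go down, the rest follows [N]. *)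
pose n' x := if x \in ends P then up x else if x \in segment a k then n x
  else if x \in ends (map_pairs up P) then phi k.-1 (crd x) else mate N x.
have n'P x : x \in ends P -> n' x = up x by rewrite /n' => ->.
have n'B x : x \in B -> n' x = n x.
  by rewrite !inE /n' inE => /andP[/negPf-> ->].
have Pk x : idx x = k -> (x \in ends P) = false.
  by move=> xk; apply/negP=> /endP[_]; rewrite xk => /eqP; rewrite eqn_leq ltnn.
have segk x : idx x = k -> (x \in segment a k) = false.
  by move=> xk; rewrite inE xk ltnn andbF.
have n'up x : x \in ends (map_pairs up P) -> n' x = phi k.-1 (crd x).
  by move=> Ux; rewrite /n' Pk ?segk ?Ux // kP.
have n'N x : x \in ends N -> n' x = mate N x.
  by move=> Nx; have xk := kN x Nx; rewrite /n' Pk ?segk // (negPf (PN x Nx)).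
set B' := segment a k.+1 :\: [set x in ends Q].
have B'P x : x \in ends P -> x \in B'.
  move=> Px; rewrite in_setD segS segP // orbT andbT inE.
  by apply: contraTN Px => /kQ/Pk->.
have B'B x : x \in B -> x \in B'.
  rewrite in_setD => /andP[_ Sx]; rewrite in_setD segS Sx orbT andbT inE.
  by apply: contraTN Sx => /kQ/segk->.
have B'N x : x \in ends N -> x \in B'.
  move=> Nx; rewrite in_setD segS kN // eqxx inE andbT.
  by apply/negP=> /NQ; rewrite Nx.
have B'up x : x \in ends (map_pairs up P) -> x \in B'.
  move=> Ux; rewrite in_setD segS kP // eqxx inE andbT.
  by apply/negP=> /PQ; rewrite Ux.
have B'_cases x : x \in B' ->
    [\/ x \in ends P, x \in B, x \in ends (map_pairs up P) | x \in ends N].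
  rewrite in_setD segS inE -inL !mem_cat.
  case/andP=> /negPf->; rewrite orbF => /orP[/orP[Ux|Nx]|Sx].
  - by constructor 3.
  - by constructor 4.
  have [Px|Px] := boolP (x \in ends P); first by constructor 1.
  by constructor 2; rewrite in_setD inE Px.
have n'B' : pairing_on B' n'.
  move=> x /B'_cases[] Xx.
  - rewrite n'P // n'up ?upP // down_up //; split=> //; first exact/B'up/upP.
    by apply: contraTneq (segP x Xx) => <-; rewrite segk.
  - by have [Bnx nnx nx_neq] := nB x Xx; rewrite !n'B //; split; rewrite ?B'B.
  - rewrite n'up // n'P ?Pdown // up_down //; split=> //; first exact/B'P/Pdown.
    by apply: contraTneq (Pdown x Xx) => ->; rewrite Pk ?kP.
  have [Nx NNx x_neq _] := mateP uN Xx.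
  by rewrite !n'N //; split; rewrite ?B'N.
set R' := link (segment a k.+1) m B' n'.
have mS : pairing_on (segment a k.+1) m.
  move=> x Sx; have Sx' : x \in segment a b.
    by move: Sx; rewrite !inE => /andP[-> xk]; apply: leq_trans kb.
  have [_ mmx x_neq] := m_pairing Sx'; split=> //.
  by move: Sx; rewrite !inE m_idx.
have symR' : connect_sym R' by apply/sym_connect_sym/link_sym.
have RR' : subrel (connect R) (connect R').
  apply: connect_sub => x y /orP[]/andP[Xx /eqP->]; apply: connect1.
    by rewrite /R' /link segS Xx orbT eqxx.
  by rewrite /R' /link n'B ?B'B // eqxx orbT.
have n'R x : x \in B' -> connect R' x (n' x).
  by move=> Bx; apply: connect1; rewrite /R' /link Bx eqxx orbT.
have upR x : x \in ends P -> connect R' x (up x).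
  by move=> Px; rewrite -n'P // n'R // B'P.
have [] := linkL (fun x y => connect R' x y).
- exact: connect0.
- by move=> x y; rewrite symR'.
- by move=> x y z; apply: connect_trans.
- by move=> x xk; apply: connect1; rewrite /R' /link segS xk !eqxx.
- move=> p /mapP[q Pq ->] /=.
  have P1 : q.1 \in ends P by apply/mem_ends; exists q; auto.
  have P2 : q.2 \in ends P by apply/mem_ends; exists q; auto.
  apply: connect_trans (upR _ P2); rewrite symR'.
  by apply: connect_trans (upR _ P1); rewrite symR' RR' ?joinP.
- move=> p Np; have N1 : p.1 \in ends N by apply/mem_ends; exists p; auto.
  by have [<- _] := mate_mem uN Np; rewrite -n'N // n'R ?B'N.
move=> coverQ joinQ; exists n'; split=> //.
- by move=> x Qx; rewrite kQ.
- move=> x /B'_cases[] Xx.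
  + by rewrite n'P ?g_updown.
  + by rewrite n'B ?gB.
  + by rewrite n'up // g_sym -{2}(up_down x Xx) g_updown ?Pdown.
  have [_ _ _ []] := mateP uN Xx; rewrite n'N // => /gN //.
  by rewrite g_sym.
move=> x; rewrite segS => /orP[/eqP/coverQ//|Sx].
have [y Py xy] := coverP x Sx.
have [z Qz yz] := coverQ (up y) (idx_up y); exists z => //.
exact: connect_trans (RR' _ _ xy) (connect_trans (upR y Py) yz).
Qed.


(** One open path is left, and every vertex is tied to one of its ends; the edge [u v] completes the
    matching and connects everything. *)
Lemma reach_close u v : u != v -> g u v -> reach b [:: (u, v)] ->
  exists n, good g (segment a b) m n.
Proof.
move=> uv_neq guv [n [endP nB gB coverP joinP]].
have [au ub] : a <= idx u /\ (idx u).+1 = b by apply: endP; rewrite inE eqxx.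
have [av vb] : a <= idx v /\ (idx v).+1 = b by apply: endP; rewrite !inE eqxx orbT.
have Su : u \in segment a b by rewrite inE au -ub leqnn.
have Sv : v \in segment a b by rewrite inE av -vb leqnn.
set B := segment a b :\: _ in nB gB coverP joinP.
set R := link _ m B n in coverP joinP.
have inB x : (x \in B) = [&& x != u, x != v & x \in segment a b].
  by rewrite in_setD !inE negb_or -andbA.
pose n' x := if x == u then v else if x == v then u else n x.
have n'u : n' u = v by rewrite /n' eqxx.
have n'v : n' v = u by rewrite /n' eq_sym (negPf uv_neq) eqxx.
have n'B x : x \in B -> n' x = n x.
  by rewrite inB /n' => /and3P[/negPf-> /negPf->].
have cases x : x \in segment a b -> [\/ x = u, x = v | x \in B].
  move=> Sx; have [->|xu] := eqVneq x u; first by constructor 1.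
  have [->|xv] := eqVneq x v; first by constructor 2.
  by constructor 3; rewrite inB xu xv.
have BS x : x \in B -> x \in segment a b by rewrite in_setD => /andP[].
have n'S : pairing_on (segment a b) n'.
  move=> x /cases[->|->|Bx]; rewrite ?n'u ?n'v; first by split; rewrite // eq_sym.
    by split.
  by have [Bnx nnx x_neq] := nB x Bx; rewrite !n'B //; split; rewrite ?BS.
exists n'; set R' := link (segment a b) m (segment a b) n'.
have symR' : connect_sym R' by apply/sym_connect_sym/link_sym.
have RR' : subrel (connect R) (connect R').
  apply: connect_sub => x y /orP[]/andP[Xx /eqP->]; apply: connect1.
    by rewrite /R' /link Xx eqxx.
  by rewrite /R' /link BS ?n'B // eqxx orbT.
have toU x : x \in segment a b -> connect R' x u.
  move=> /coverP[y + /RR' xy]; rewrite !inE => /orP[]/eqP eq_y; rewrite eq_y in xy => //.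
  by apply: connect_trans xy (connect1 _); rewrite /R' /link Sv n'v eqxx orbT.
split=> // [x /cases[->|->|Bx]|x y Sx Sy]; first by rewrite n'u.
- by rewrite n'v g_sym.
- by rewrite n'B ?gB.
by apply: connect_trans (toU x Sx) _; rewrite symR' toU.
Qed.

(** [psi] accumulates the symmetries met so far: the actual states are images of the fixed families.
    The pairing of layer [k] is pulled back along [psi] and looked up in the certificate. *)
Lemma reach_next k psi F : a <= k < b -> cube_automorphism psi ->
    F \in [:: [::]] :: families ->
    (forall P, P \in F -> reach k (map_pairs (fun v => phi k.-1 (psi v)) P)) ->
  exists psi' F', [/\ cube_automorphism psi', F' \in families
    & forall P, P \in F' -> reach k.+1 (map_pairs (fun v => phi k (psi' v)) P)].
Proof.
move=> ak_b [psi_inj psi_adj] famF reachF; have /andP[ak kb] := ak_b.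
have k_len : k < len := leq_trans kb le_b.
pose psi1 := invF psi_inj; pose e v := phi k (psi v).
have crd_e v : crd (e v) = psi v by rewrite crd_phi.
have idx_e v : idx (e v) = k by rewrite idx_phi.
have eK x : idx x = k -> e (psi1 (crd x)) = x.
  by move=> xk; rewrite /e f_invF -xk phiK.
have e_inj : injective e by move=> u v /(congr1 crd); rewrite !crd_e => /psi_inj.
have Sk x : idx x = k -> x \in segment a b by move=> xk; rewrite inE xk ak.
pose f v := psi1 (crd (m (e v))).
have ef v : e (f v) = m (e v) by rewrite eK // m_idx ?Sk // idx_e.
have [|||q q_in [fq end_q]] := @pairings_complete _ 4 cube_enum f.
- by [].
- by [].
- move=> v _; have [_ mme e_neq] := m_pairing (Sk _ (idx_e v)).
  split; first exact: mem_cube_enum.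
    by apply: e_inj; rewrite !ef.
  by apply: contraNneq e_neq => eq_f; rewrite -ef eq_f.
have [row rowF] := all2_mem certificate_ok famF.
have [c /andP[c_lt /allP okF']] := all2_mem rowF q_in.
set t := nth id cube_syms _ in okF'; have [t_inj t_adj] := cube_syms_nth (c %% 48).
exists (psi \o t), (nth [::] families (c %/ 48)); split.
- split=> [|u v /=]; first exact: inj_comp.
  by rewrite psi_adj t_adj.
- exact: mem_nth.
move=> P' /okF'/hasP[[P s]]; rewrite mem_pmap => /mapP[P0 FP].
case def_s: (merge_paths P0 q) => [s0|] // [eqP eqs].
rewrite -{}eqP -{}eqs in FP def_s * => {P0 s0} /=.
case/hasP=> N _ /andP[/allP adjN]; case def_r: merge_paths => [r|] //.
set P'' := map_pairs t P'; set L := _ ++ _ => /andP[/andP[same_r uL] /eqP sL].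
(* Eight distinct vertices exhaust the cube. *)
have inL v : v \in L.
  have /card_uniqP cardL := uL.
  have : L =i predT.
    by apply/subset_cardP; rewrite ?subset_predT // cardL sL !card_prod !card_bool.
  by move=> ->.
have eP : map_pairs (fun x => phi k (crd x)) (map_pairs (fun v => phi k.-1 (psi v)) P)
    = map_pairs e P.
  rewrite /map_pairs -map_comp; apply: eq_map => p /=.
  by rewrite !crd_phi // (leq_ltn_trans (leq_pred k)).
have eP' : map_pairs (fun v => phi k ((psi \o t) v)) P' = map_pairs e P''.
  by rewrite /P'' /map_pairs -map_comp.
rewrite eP' {eP'}; clearbody P''; apply: (reach_step ak_b (reachF P FP) (N := map_pairs e N)).
- by rewrite eP !ends_map -!map_cat (map_inj_uniq e_inj).
- move=> x; rewrite eP !ends_map -!map_cat; apply/mapP/eqP => [[v _ ->]//|xk].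
  by exists (psi1 (crd x)); rewrite ?inL ?eK.
- by move=> p /mapP[p0 Np ->]; apply: g_layer; rewrite // psi_adj adjN.
move=> C Crefl Csym Ctrans Cm; rewrite eP => joinP joinN.
pose C' u v := C (e u) (e v).
have Crefl' u : C' u u by apply: Crefl.
have Csym' u v : C' u v -> C' v u by apply: Csym.
have Ctrans' u v w : C' u v -> C' v w -> C' u w by apply: Ctrans.
have joinedP : joined C' P by move=> p Pp; apply: (joinP (e p.1, e p.2)); apply/mapP; exists p.
have joinedN : joined C' N by move=> p Pp; apply: (joinN (e p.1, e p.2)); apply/mapP; exists p.
have joinedq : joined C' q by move=> p /fq; rewrite /C' => <-; rewrite ef; apply: Cm.
have coverq : covering C' q.
  by move=> v; exists v; [rewrite end_q mem_cube_enum | apply: Crefl].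
have [js cs] := @merge_joined _ C' Crefl' Csym' Ctrans' _ _ _ def_s joinedP joinedq coverq.
have [jr cr] := @merge_joined _ C' Crefl' Csym' Ctrans' _ _ _ def_r joinedN js cs.
have [jP cP] := @same_pairs_joined _ C' Csym' _ _ same_r jr cr.
split=> [x xk|p /mapP[p0 Pp ->]]; last exact: jP.
have [v Pv Cv] := cP (psi1 (crd x)); exists (e v); first by rewrite ends_map map_f.
by move: Cv; rewrite /C' eK.
Qed.

Lemma noncrossing_good : a < b -> exists n, good g (segment a b) m n.
Proof.
move=> ab.
have [psi [F [[psi_inj psi_adj] famF reachF]]] :
    exists psi F, [/\ cube_automorphism psi, F \in families
      & forall P, P \in F -> reach b (map_pairs (fun v => phi b.-1 (psi v)) P)].
  suffices H i : a + i < b -> exists psi F, [/\ cube_automorphism psi, F \in families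
      & forall P, P \in F -> reach (a + i).+1 (map_pairs (fun v => phi (a + i) (psi v)) P)].
    have b_gt0 : 0 < b := leq_ltn_trans (leq0n a) ab.
    have eq_b : a + (b.-1 - a) = b.-1 by rewrite subnKC // -ltnS prednK.
    by have := H (b.-1 - a); rewrite eq_b prednK // leqnn; apply.
  elim: i => [|i IHi] ai_b.
    (* Below the first layer the only state is [[::]], so no vertex of layer [a.-1] is involved,
       even for [a = 0]. *)
    rewrite addn0 in ai_b *; apply: (@reach_next _ id [:: [::]]); first by rewrite leqnn.
    - by split.
    - exact: mem_head.
    by move=> P; rewrite inE => /eqP->; apply: reach0.
  have [|psi [F [aut_psi famF reachF]]] := IHi; first by rewrite ltnW // -addnS.
  rewrite addnS in ai_b *; apply: reach_next aut_psi _ reachF.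
    by rewrite ai_b ltnW // ltnS leq_addr.
  by rewrite in_cons famF orbT.
have /hasP[[|[u v] [|]] // FP adj_uv] := allP families_closable F famF.
have b_len : b.-1 < len by rewrite prednK // (leq_ltn_trans (leq0n a) ab).
apply: reach_close (reachF _ FP); last by apply: g_layer; rewrite // psi_adj.
apply: contraTneq adj_uv => /(congr1 crd); rewrite !crd_phi // => /psi_inj /= ->.
by rewrite /cube_adj !eqxx.
Qed.

End NonCrossing.

(** Induction on the number of layers: if a pair joins different layers, a cut between them gives
    two shorter segments to be glued; otherwise the transfer argument applies. *)
Theorem segment_hamiltonian a b : b <= len -> hamiltonian_on g (segment a b).
Proof.
have [k] := ubnP (b - a); elim: k a b => // k IHk a b le_k le_b.
split=> [|m mS]; first exact: segment_even.
have [ab|ba] := ltnP a b; last first.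
  have seg0 x : (x \in segment a b) = false.
    by apply/negP; rewrite inE => /andP[ax xb]; have := leq_trans xb ba; rewrite ltnNge ax.
  by exists id; split=> x; rewrite seg0.
have [/forall_inP m_idx|] := boolP [forall x in segment a b, idx (m x) == idx x].
  by apply: noncrossing_good => // x /m_idx/eqP.
case/forall_inPn=> x Sx mx_neq.
wlog lt_x : x Sx mx_neq / idx x < idx (m x).
  have [Smx mmx _] := mS x Sx; case: (ltngtP (idx x) (idx (m x))) => [ltx|ltx|eqx] WH.
  - exact: WH ltx.
  - by apply: (WH (m x)); rewrite ?mmx // eq_sym.
  by rewrite eqx eqxx in mx_neq.
(* Cutting just below the layer of the higher end [m x] leaves both parts nonempty. *)
have [Smx _ _] := mS x Sx; set c := idx (m x) in lt_x.
move: (Sx) (Smx); rewrite !inE -/c => /andP[ax xb] /andP[ac cb].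
have ltac : a < c := leq_ltn_trans ax lt_x.
have eqS : segment a b = segment a c :|: segment c b.
  apply/setP=> y; rewrite !inE; have [yc|cy] := ltnP (idx y) c => /=.
    by rewrite (ltn_trans yc cb) orbF.
  by rewrite andbF /= (leq_trans ac cy).
rewrite eqS in mS *; apply: (@hamiltonian_glue _ _ _ _ _ x) => //.
- rewrite -setI_eq0; apply/eqP/setP=> y; rewrite !inE.
  by case: (ltnP (idx y) c); rewrite ?andbF.
- apply: IHk; last exact: ltnW (leq_trans cb le_b).
  by rewrite -ltnS (leq_trans _ le_k) // ltnS ltn_sub2r.
- apply: IHk => //.
  by rewrite -ltnS (leq_trans _ le_k) // ltnS ltn_sub2l.
- by rewrite inE ax.
by rewrite inE leqnn.
Qed.

End CubeString.

(** * Hamiltonian paths in iterated prisms *)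

Section SortedCat.
Variables (T : Type) (e : rel T).

Lemma sorted_cat_rcons s x y t :
  sorted e (rcons s x) -> e x y -> sorted e (y :: t) -> sorted e (rcons s x ++ y :: t).
Proof.
case: s => [|z s] /= => [_ ->//|]; rewrite cat_path last_rcons => -> /= -> //.
Qed.

End SortedCat.

Definition path_cover (G : sgraph) (U : {set G}) (s : seq G) :=
  [/\ uniq s, sorted (@adj G) s & s =i U].

Lemma path_cover_cat (G : sgraph) (U V : {set G}) s t :
    path_cover U s -> path_cover V t -> [disjoint U & V] ->
    (forall s1 x y t1, s = rcons s1 x -> t = y :: t1 -> adj x y) ->
  path_cover (U :|: V) (s ++ t).
Proof.
move=> [us es sU] [ut et tV] disUV joint; split=> [||x].
- rewrite cat_uniq us ut andbT; apply/hasPn=> x; rewrite sU tV => Vx.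
  by rewrite (disjointFl disUV).
- case: t et joint {ut tV} => [|y t]; first by rewrite cats0.
  case: (lastP s) es {us sU} => // s1 x es et joint.
  by apply: sorted_cat_rcons => //; apply: joint.
by rewrite mem_cat sU tV inE.
Qed.

Lemma path_cover_rev (G : sgraph) (U : {set G}) s :
  path_cover U s -> path_cover U (rev s).
Proof.
move=> [us es sU]; split=> [||x]; rewrite ?rev_uniq ?mem_rev //.
by rewrite rev_sorted; apply: sub_sorted es => x y; rewrite adj_sym.
Qed.

Section Prism.
Variable G : sgraph.
Implicit Types (U V : {set G}) (s : seq G).

Definition copy (c : bool) U : {set prism G} := [set x : prism G | (x.1 \in U) && (x.2 == c)].
Definition embed (c : bool) s : seq (prism G) := [seq ((x, c) : prism G) | x <- s].

Lemma prism_adj_same (x y : G) (c : bool) :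
  @adj (prism G) (x, c) (y, c) = adj x y.
Proof. by rewrite /= /box_rel /= eqxx andbF andbT. Qed.

Lemma prism_adj_copy (x : G) (c : bool) : @adj (prism G) (x, c) (x, ~~ c).
Proof. by rewrite /= /box_rel /= eqxx; case: c. Qed.

Lemma path_cover_embed c U s : path_cover U s -> path_cover (copy c U) (embed c s).
Proof.
move=> [us es sU]; split=> [||[x d]].
- by rewrite map_inj_uniq // => x y [].
- by rewrite sorted_map; apply: sub_sorted es => x y; apply: etrans (prism_adj_same x y c).
rewrite inE /=; apply/mapP/andP => [[y sy [-> ->]]|[Ux /eqP->]].
  by rewrite -sU.
by exists x; rewrite ?sU.
Qed.

Lemma copy_disjoint c d U V : (c != d) || [disjoint U & V] ->
  [disjoint copy c U & copy d V].
Proof.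
move=> cdUV; rewrite -setI_eq0; apply/eqP/setP=> -[x e]; rewrite !inE /=.
case/orP: cdUV => [|dis].
  by case: c d e => [] [] [] //= _; rewrite ?andbF.
by apply/negP=> /andP[/andP[Ux _] /andP[Vx _]]; rewrite (disjointFr dis) in Vx.
Qed.

(** One copy is traversed forwards and the other backwards, with a crossing at the last vertex. *)
Lemma path_cover_zigzag c U s : path_cover U s ->
  path_cover (copy c U :|: copy (~~ c) U) (embed c s ++ rev (embed (~~ c) s)).
Proof.
move=> sU; apply: path_cover_cat.
- exact: path_cover_embed.
- exact/path_cover_rev/path_cover_embed.
- by apply: copy_disjoint; case: c.
move=> s1 x y t1; rewrite /embed -map_rev; case: (lastP s) => [|s' z].
  by case: s1.
rewrite map_rcons rev_rcons => /rcons_inj[_ <-] [<- _].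
exact: prism_adj_copy.
Qed.

End Prism.

Section IteratedPrism.
Variable G : sgraph.
Implicit Types (U : {set G}) (p : seq G).

Fixpoint base j : iter j prism G -> G :=
  if j is j'.+1 then fun x => base x.1 else id.

Definition over j U : {set iter j prism G} := [set x | base x \in U].

Lemma base_surj j a : exists v : iter j prism G, base v = a.
Proof. by elim: j => [|j [v <-]]; [exists a | exists (v, true)]. Qed.

Lemma base_lift j a (v : iter j prism G) : adj (base v) a ->
  exists2 w, base w = a & adj v w.
Proof.
elim: j v => [v|j IHj [v c] /IHj[w wa vw]]; first by exists a.
by exists (w, c); rewrite // prism_adj_same.
Qed.

Lemma over_copy j U : over j.+1 U = copy true (over j U) :|: copy false (over j U).
Proof. by apply/setP=> -[x []]; rewrite !inE /= ?andbT ?andbF ?orbF. Qed.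

(** Zigzags that begin in whichever copy contains the start: the first vertex above [a] can be
    prescribed, as attaching a leg requires. *)
Lemma path_cover_over j a p (v : iter j prism G) :
    base v = a -> uniq (a :: p) -> path (@adj G) a p ->
  exists s, path_cover (over j [set x in a :: p]) (v :: s).
Proof.
move=> va up ep; elim: j v va => [v /= -> | j IHj [v c] /= va].
  by exists p; split=> // x; rewrite !inE.
have [s sU] := IHj v va.
have := path_cover_zigzag c sU; rewrite over_copy /=.
by case: c => ?; eexists; [|rewrite setUC]; eassumption.
Qed.

Lemma path_cover_overS j U s : path_cover (over j U) s ->
  exists t, path_cover (over j.+1 U) t.
Proof.
by move/(path_cover_zigzag true); rewrite -over_copy => tU; eexists; exact: tU.
Qed.

(* Cutting [s] after a point [v] above [b] as [s1 ++ s2], the new path runs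
   through a copy of [s2], the whole of [s] backwards in the other copy, and
   then [s1], ending at a copy of [v], which is adjacent to the leg. *)
Lemma path_cover_leg j U s a b p :
    path_cover (over j U) s -> b \in U -> adj b a -> uniq (a :: p) ->
    path (@adj G) a p -> [disjoint U & [set x in a :: p]] ->
  exists t, path_cover (over j.+1 (U :|: [set x in a :: p])) t.
Proof.
move=> sU Ub ba up ep dis.
have [v vb] := base_surj j b.
have [us es s_in] := sU.
have [w wa vw] : exists2 w, base w = a & adj v w by apply: base_lift; rewrite vb.
have sv : v \in s by rewrite s_in inE vb.
have [s1 [s2 def_s]] : exists s1 s2, s = rcons s1 v ++ s2.
  by case/splitPr: sv => s1 s2; exists s1, s2; rewrite cat_rcons.
have [U1 [U2 [s1U s2U dis12 eqU]]] : exists U1 U2 : {set iter j prism G},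
    [/\ path_cover U1 (rcons s1 v), path_cover U2 s2, [disjoint U1 & U2]
      & over j U = U1 :|: U2].
  exists [set x in rcons s1 v], [set x in s2]; move: us es.
  rewrite def_s cat_uniq => /and3P[u1 /hasPn u12 u2] e12.
  split.
  - split=> // [|x]; last by rewrite inE.
    by move: e12; case: (rcons s1 v) => //= x t; rewrite cat_path => /andP[].
  - split=> // [|x]; last by rewrite inE.
    by move: e12; case: (s1) => /= [|x t]; rewrite ?cat_path;
      [move/path_sorted | move=> /andP[_] /path_sorted].
  - rewrite -setI_eq0; apply/eqP/setP=> x; rewrite !inE.
    by apply/negP=> /andP[x1 /u12]; rewrite /= x1.
  by apply/setP=> x; rewrite -s_in def_s mem_cat !inE.
(* The part above the leg is entered at [(w, true)], a neighbour of [(v, true)], where the path over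
   [U] will end. *)
have [q qV] := path_cover_over (j := j.+1) (v := (w, true)) wa up ep.
have cover1 : path_cover (copy true U2 :|: copy false (over j U))
    (embed true s2 ++ rev (embed false s)).
  apply: path_cover_cat.
  - exact: path_cover_embed.
  - exact/path_cover_rev/path_cover_embed.
  - exact: copy_disjoint.
  move=> t1 x y t2; rewrite def_s /embed -map_rev rev_cat.
  case: (lastP s2) => [|s3 z]; first by case: t1.
  rewrite map_rcons rev_rcons => /rcons_inj[_ <-] [<- _].
  exact: (prism_adj_copy _ true).
have cover2 : path_cover (copy true U2 :|: copy false (over j U) :|: copy true U1)
    ((embed true s2 ++ rev (embed false s)) ++ embed true (rcons s1 v)).
  apply: path_cover_cat => //; first exact: path_cover_embed.
    rewrite -setI_eq0 setIUl setU_eq0 !setI_eq0 !copy_disjoint //=.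
    by rewrite disjoint_sym.
  move=> t1 x y t2; rewrite def_s; case: (rcons s1 v) (size_rcons s1 v) => //= h r _.
  rewrite rev_cons -rcons_cat => /rcons_inj[_ <-] [<- _].
  exact: (prism_adj_copy _ false).
exists (((embed true s2 ++ rev (embed false s)) ++ embed true (rcons s1 v)) ++ (w, true) :: q).
have -> : over j.+1 (U :|: [set x in a :: p]) =
    (copy true U2 :|: copy false (over j U) :|: copy true U1)
      :|: over j.+1 [set x in a :: p].
  have Uj x : (base x \in U) = (x \in U1) || (x \in U2).
    by have /setP/(_ x) := eqU; rewrite !inE.
  apply/setP=> -[x c]; rewrite inE in_setU /= !in_setU !inE /= Uj.
  by case: c; rewrite ?andbT ?andbF ?orbF //=; case: (x \in U1); case: (x \in U2).
apply: path_cover_cat => //.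
  rewrite -setI_eq0; apply/eqP/setP=> -[x c]; rewrite !inE /=; apply/negP=> /andP[Ux].
  have Ubx : base x \in U.
    have /setP/(_ x) := eqU; rewrite !inE => ->.
    move: Ux; have /setP/(_ x) := eqU; rewrite !inE => ->.
    by case/orP=> [/orP[]|] /andP[-> _]; rewrite ?orbT.
  by have := disjointFr dis Ubx; rewrite !inE => ->.
move=> t1 x y t2; rewrite /embed map_rcons -rcons_cat => /rcons_inj[_ <-] [<- _].
by rewrite prism_adj_same.
Qed.

End IteratedPrism.

Section Greedy.
Variables (G : sgraph) (W : {set G}) (I : {set G} -> Prop) (r : G).
Hypothesis I_start : I [set r].
Hypothesis I_leg : forall U, I U -> U != [set: G] -> exists b a p,
  [/\ b \in U, adj b a, uniq (a :: p) /\ path (@adj G) a p,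
      [disjoint U & [set x in a :: p]] /\ I (U :|: [set x in a :: p])
    & exists2 x, x \in a :: p & x \in W].

(** Each leg covers a new point of [W] and costs one prism, so at most [#|W|] are spent; zigzags
    absorb the others. [I] is the property of the covered set that guarantees a further leg. *)
Lemma traceable_greedy :
  exists s, path_cover [set: iter #|W| prism G] s.
Proof.
have overT j : over j [set: G] = [set: iter j prism G].
  by apply/setP=> x; rewrite !inE.
suffices [j le_j [s sT]] : exists2 j, j <= #|W| & exists s, path_cover (over j [set: G]) s.
  rewrite -overT -(subnK le_j); elim: (_ - _) => [|i [t tT]]; first by exists s.
  exact: path_cover_overS tT.
suffices H n U j s : #|~: U| < n -> I U -> path_cover (over j U) s -> j <= #|U :&: W| ->
    exists2 j, j <= #|W| & exists s, path_cover (over j [set: G]) s.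
  apply: (H #|~: [set r]|.+1 [set r] 0 [:: r]) => //.
  by split=> // x; rewrite !inE.
elim: n U j s => // n IHn U j s leU IU sU le_j.
have [eqU|neU] := eqVneq U [set: G].
  exists j; first by rewrite eqU setTI in le_j.
  by exists s; rewrite -eqU.
have [b [a [p [Ub ba [up ep] [dis IU'] [x px Wx]]]]] := I_leg IU neU.
have [t tU'] := path_cover_leg sU Ub ba up ep dis.
have Ux : x \notin U by apply: contraTN px => /(disjointFr dis); rewrite inE => ->.
apply: IHn IU' tU' _.
  apply: (leq_trans _ (ltnSE leU)); apply: proper_card; rewrite properC properE subsetUl /=.
  by apply: contraNN Ux => /subsetP; apply; rewrite in_setU in_set px orbT.
apply: leq_ltn_trans le_j _; apply: proper_card; rewrite properE setSI ?subsetUl //=.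
apply: contraNN Ux => /subsetP/(_ x); rewrite !in_setI in_setU in_set px Wx orbT.
by move=> /(_ isT); case/andP.
Qed.

End Greedy.

(** * Legs of a spanning tree *)

Lemma exit_edge (T : finType) (e : rel T) (U : {set T}) x :
    (forall y, connect e x y) -> x \in U -> U != [set: T] ->
  exists b a, [/\ b \in U, a \notin U & e b a].
Proof.
move=> conn_x Ux neU.
have [/existsP[b /existsP[a /and3P[]]]|no_exit] :=
    boolP [exists b, exists a, [&& b \in U, a \notin U & e b a]].
  by exists b, a.
case/eqP: neU; apply/setP=> y; rewrite inE.
apply: (connect_invariant (P := mem U)) (conn_x y) Ux => u v uv Uu.
apply: contraNT no_exit => Uv; apply/existsP; exists u; apply/existsP; exists v.
exact/and3P.
Qed.

Section TreeLegs.
Variable H : sgraph.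
Hypotheses (Hconn : connected H) (Hacyclic : acyclic H).
Implicit Types (U : {set H}) (p : seq H).

Definition adj_in U : rel H := fun x y => [&& x \in U, y \in U & adj x y].
Definition connected_in U := {in U &, forall x y, connect (adj_in U) x y}.

Lemma connected_in_add U b a :
  connected_in U -> b \in U -> adj b a -> connected_in (a |: U).
Proof.
move=> cU Ub ba; pose e := adj_in (a |: U).
have sym_e : connect_sym e.
  by apply: sym_connect_sym => x y; rewrite /e /adj_in adj_sym andbCA.
have toU x y : x \in U -> y \in U -> connect e x y.
  move=> Ux Uy; apply: connect_sub (cU x y Ux Uy) => u v /and3P[Uu Uv uv].
  by apply: connect1; rewrite /e /adj_in !inE Uu Uv !orbT.
have toB x : x \in a |: U -> connect e x b.
  rewrite !inE => /predU1P[->|Ux]; last exact: toU.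
  by apply: connect1; rewrite /e /adj_in !inE eqxx Ub orbT adj_sym.
by move=> x y /toB xb /toB yb; apply: connect_trans xb _; rewrite -/e sym_e.
Qed.

Lemma connected_in_path U b p : connected_in U -> b \in U ->
  path (@adj H) b p -> connected_in (U :|: [set x in p]).
Proof.
elim: p U b => [|a p IHp] U b cU Ub /=.
  by move=> _; rewrite (_ : [set x in [::]] = set0) ?setU0 //; apply/setP=> x; rewrite !inE.
case/andP=> ba ap; have := IHp (a |: U) a (connected_in_add cU Ub ba) (setU11 a U) ap.
congr connected_in; apply/setP=> x; rewrite !inE.
by case: (x == a); rewrite ?orbT.
Qed.

Lemma maximal_leg U a : a \notin U -> exists p,
  [/\ uniq (a :: p), path (@adj H) a p, [disjoint U & [set x in a :: p]]
    & forall y, adj (last a p) y -> (y \in U) || (y \in a :: p)].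
Proof.
move=> Ua.
suffices E n p : #|H| < size p + n -> uniq (a :: p) -> path (@adj H) a p ->
    [disjoint U & [set x in a :: p]] -> exists p,
    [/\ uniq (a :: p), path (@adj H) a p, [disjoint U & [set x in a :: p]]
      & forall y, adj (last a p) y -> (y \in U) || (y \in a :: p)].
  apply: (E #|H|.+1 [::]) => //; rewrite -setI_eq0; apply/eqP/setP=> x.
  by rewrite !inE; apply: contraNF Ua => /andP[Ux /eqP<-].
elim: n p => [|n IHn] p le_n up ep dis.
  have : size (a :: p) <= #|H| by rewrite -(card_uniqP up) max_card.
  by rewrite addn0 in le_n => /leq_trans/(_ (ltnW le_n)); rewrite ltnn.
have [/existsP[y /and3P[ay Uy py]]|] :=
    boolP [exists y, [&& adj (last a p) y, y \notin U & y \notin a :: p]]; last first.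
  rewrite negb_exists => /forallP ext; exists p; split=> // y ay.
  by have := ext y; rewrite ay /= negb_and !negbK.
apply: (IHn (rcons p y)).
- by rewrite size_rcons addSnnS.
- by rewrite -rcons_cons rcons_uniq py.
- by rewrite rcons_path ep.
rewrite -setI_eq0; apply/eqP/setP=> x; rewrite in_setI !in_set -rcons_cons mem_rcons in_cons.
apply/negP=> /andP[Ux /predU1P[eq_x|px]]; first by rewrite -eq_x Ux in Uy.
by have := disjointFr dis Ux; rewrite in_set px.
Qed.

(** The last vertex [x] of a maximal path leaving [U] is a leaf: a second neighbour would lie in [U]
    or on the path, which stay connected without [x], and so would close a cycle. *)
Lemma tree_leg U : connected_in U /\ U != set0 -> U != [set: H] -> exists b a p,
  [/\ b \in U, adj b a, uniq (a :: p) /\ path (@adj H) a p,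
      [disjoint U & [set x in a :: p]] /\
        (connected_in (U :|: [set x in a :: p]) /\ U :|: [set x in a :: p] != set0)
    & exists2 x, x \in a :: p & x \in leaves H].
Proof.
case=> cU /set0Pn[r Ur] neU.
have connH x y : connect (@adj H) x y.
  by case/andP: Hconn => _ /forallP/(_ x)/forallP/(_ y).
have [b [a [Ub Ua ba]]] := exit_edge (connH r) Ur neU.
have [p [up ep dis ext]] := maximal_leg Ua.
have bap : path (@adj H) b (a :: p) by rewrite /= ba.
exists b, a, p; split=> //.
  split=> //; split; first exact: connected_in_path bap.
  by apply/set0Pn; exists b; rewrite inE Ub.
set x := last a p in ext; exists x; first exact: mem_last.
move: up bap; rewrite lastI -/x; set p0 := belast a p => up.
rewrite rcons_path => /andP[bp0 p0x].
(* [C] is [U] and the leg without [x]; [y0] precedes [x], and is [b] when the leg has one vertex. *)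
have cC := connected_in_path cU Ub bp0; set C := _ :|: _ in cC.
set y0 := last b p0 in p0x.
have Cy0 : y0 \in C.
  by have := mem_last b p0; rewrite -/y0 !inE => /predU1P[->|->]; rewrite ?Ub ?orbT.
have xC : x \notin C.
  rewrite !inE negb_or; move: up; rewrite rcons_uniq => /andP[-> _]; rewrite andbT.
  by apply/negP=> Ux; have := disjointFr dis Ux; rewrite in_set mem_last.
suffices nbr y : adj x y -> y = y0.
  rewrite inE (_ : [set y | adj x y] = [set y0]) ?cards1 //.
  apply/setP=> y; rewrite !inE; apply/idP/eqP => [/nbr //|->].
  by rewrite adj_sym.
move=> xy; apply/eqP; apply: contraT => y_neq.
have Cy : y \in C.
  have := ext y xy; rewrite lastI mem_rcons !inE -/p0 -/x => /or3P[->//|/eqP eq_y|->].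
    by rewrite eq_y adj_irrefl in xy.
  by rewrite orbT.
(* A simple path from [y0] to [y] inside [C] avoids [x]; adding [x] gives a cycle, of length at
   least three because [y] differs from [y0]. *)
have /connectP[q0 yq0 eq_y] := cC y0 y Cy0 Cy; rewrite {y}eq_y in y_neq xy {Cy} *.
case/shortenP: yq0 y_neq xy => q yq uq _ y_neq xy.
have qC : all (mem C) (y0 :: q).
  rewrite /= Cy0 /=; elim: q y0 Cy0 yq {uq y_neq xy p0x} => //= z q IHq y1 Cy1.
  by case/andP=> /and3P[_ Cz _] /(IHq z Cz) ->; rewrite Cz.
have eq0 : path (@adj H) y0 q by apply: sub_path yq => u v /and3P[].
case: (acyclicP _ Hacyclic [:: x, y0 & q]).
  by case: (q) y_neq => //=; rewrite eqxx.
apply/andP; split.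
  rewrite /= adj_sym p0x rcons_path eq0 /= adj_sym //.
rewrite cons_uniq uq andbT; apply: contra xC => qx.
exact: (allP qC).
Qed.

End TreeLegs.

Lemma edges_adj (G : sgraph) (S : {set {set G}}) x y :
  S \subset edges G -> edge_rel S x y -> adj x y.
Proof.
move=> /subsetP sSG /andP[xy /sSG/imsetP[[u v]]]; rewrite inE /= => uv eq_xy.
have : x \in [set u; v] by rewrite -eq_xy !inE eqxx.
have : y \in [set u; v] by rewrite -eq_xy !inE eqxx orbT.
rewrite !inE => /orP[]/eqP eqy /orP[]/eqP eqx; rewrite eqx eqy ?eqxx // in xy *.
by rewrite adj_sym.
Qed.

(** Legs of a spanning tree are paths of [G], and each contains a new leaf; so [W] is the set of
    leaves of a tree attaining [ml G]. *)
Lemma traceable_ml (G : sgraph) : connected G ->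
  exists s, path_cover [set: iter (ml G) prism G] s.
Proof.
move=> Gconn; have /andP[/card_gt0P[r _] /forallP connG] := Gconn.
have [/existsP[S0 treeS0]|noS] := boolP [exists S : {set {set G}}, spanning_tree S].
  have [S /andP[sSG /andP[Sconn Sacyc]] ->] := ml_attained treeS0.
  refine (@traceable_greedy G (leaves (edge_graph S))
            (fun U => @connected_in (edge_graph S) U /\ U != set0) r _ _).
    split; last by apply/set0Pn; exists r; rewrite inE.
    by move=> x y; rewrite !inE => /eqP-> /eqP->; apply: connect0.
  move=> U IU neU.
  have [b [a [p [Ub ba [up ep] [dis IU'] leg]]]] :=
    @tree_leg (edge_graph S) Sconn Sacyc U IU neU.
  exists b, a, p; split=> //; first exact: edges_adj sSG ba.
  by split=> //; apply: sub_path ep => x y; apply: edges_adj sSG.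
(* Rather than proving that a spanning tree exists, use the default value of
   [ml], which allows legs that consist of a single vertex. *)
have -> : ml G = #|[set: G]|.
  rewrite cardsT /ml big_pred0 // => S; apply/negP=> HS.
  by case/existsP: noS; exists S.
refine (@traceable_greedy G [set: G] (fun U => U != set0) r _ _).
  by apply/set0Pn; exists r; rewrite inE.
move=> U /set0Pn[x Ux] neU.
have [b [a [Ub Ua ba]]] := exit_edge (fun y => forallP (connG x) y) Ux neU.
exists b, a, [::]; split=> //.
  split; last by apply/set0Pn; exists x; rewrite inE Ux.
  rewrite -setI_eq0; apply/eqP/setP=> y; rewrite !inE.
  by apply: contraNF Ua => /andP[Uy /eqP<-].
by exists a; rewrite ?mem_head ?inE.
Qed.

(** * From connected links to Hamiltonian cycles *)

Lemma prism_adjE (G : sgraph) (x y : G) (c d : bool) :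
  @adj (prism G) (x, c) (y, d) = (x == y) && (c != d) || adj x y && (c == d).
Proof. by []. Qed.

(** The position along [s] and the three prism bits are coordinates in the product of a path with
    the cube. *)
Lemma traceable_hamiltonian_on (X : sgraph) (x0 : X) s :
    path_cover [set: X] s ->
  hamiltonian_on (@adj (iter 3 prism X)) [set: iter 3 prism X].
Proof.
move=> [us es sX]; have sx x : x \in s by rewrite sX inE.
pose T := iter 3 prism X.
pose idx (x : T) := index x.1.1.1 s.
pose crd (x : T) : cube := (x.1.1.2, x.1.2, x.2).
pose phi i (v : cube) : T := (nth x0 s i, v.1.1, v.1.2, v.2).
have -> : [set: T] = segment idx 0 (size s).
  by apply/setP=> x; rewrite !inE index_mem sx.
apply: (@segment_hamiltonian T (@adj T) (size s) idx crd phi) => //.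
- by move=> [[[x a] b] c]; rewrite /phi /idx /= nth_index.
- by move=> i v lt_i; rewrite /idx /= index_uniq.
- by move=> i [[a b] c] _.
- exact: adj_sym.
- move=> i [[a b] c] [[a' b'] c'] _.
  rewrite /phi !prism_adjE !xpair_eqE adj_irrefl eqxx.
  by move: a a' b b' c c' => [] [] [] [] [] [].
move=> i v lt_i; rewrite /phi !prism_adjE !eqxx (sortedP x0 es i lt_i).
by rewrite !andbT !orbT.
Qed.

Section AlternatingCycle.
Variables (T : finType) (m n : T -> T) (x0 : T).
Hypotheses (mT : pairing_on [set: T] m) (nT : pairing_on [set: T] n).
Hypothesis mn_connected : forall x, connect (link [set: T] m [set: T] n) x0 x.

Let mK : involutive m. Proof. by move=> x; have [] := mT (in_setT x). Qed.
Let nK : involutive n. Proof. by move=> x; have [] := nT (in_setT x). Qed.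
Let m_neq x : m x != x. Proof. by have [] := mT (in_setT x). Qed.
Let n_neq x : n x != x. Proof. by have [] := nT (in_setT x). Qed.

Let p x := n (m x).
Let p_inj : injective p.
Proof. by move=> x y /(inv_inj nK)/(inv_inj mK). Qed.

(* [m] reverses the orbits of [p], so a common point of [p^k x] and [m x]
   would produce a fixed point of [m] or [n] half-way. *)
Lemma iter_alternate_neq k x : iter k p x != m x.
Proof.
suffices [] : iter k p x != m x /\ iter k.+1 p x != m x by [].
elim: k x => [|k IHk] x; first by rewrite /= eq_sym m_neq n_neq.
split; first by have [] := IHk x.
have [+ _] := IHk (p x); apply: contraNneq => eq_p; apply/eqP.
have {}eq_p : n (m (iter k.+1 p x)) = m x by exact: eq_p.
by rewrite -iterSr -[LHS]mK -[m (iter _ _ _)]nK eq_p.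
Qed.

Let o := orbit p x0.

Lemma alternate_notin x : x \in o -> m x \notin o.
Proof.
rewrite -fconnect_orbit => x0x; apply/negP; rewrite -fconnect_orbit => x0mx.
have /iter_findex eq_m : fconnect p x (m x).
  by apply: connect_trans x0mx; rewrite fconnect_sym.
by have := iter_alternate_neq (findex p x (m x)) x; rewrite eq_m eqxx.
Qed.

Let o_p x : (p x \in o) = (x \in o).
Proof.
by rewrite -!fconnect_orbit (same_connect_r (fconnect_sym p_inj) (fconnect1 p x)).
Qed.

(** The orbit [o] of [x0] under [p] holds every second vertex; inserting [m x] after each [x] lists
    the cycle in order. *)
Definition alternating_cycle := ends [seq (x, m x) | x <- o].

Lemma mem_alternating_cycle x : x \in alternating_cycle.
Proof.
have cP y : reflect (y \in o \/ m y \in o) (y \in alternating_cycle).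
  apply: (iffP (mem_ends _ _)) => [[_ /mapP[z oz ->]] /= [->|->]|[oy|omy]].
  - by left.
  - by right; rewrite mK.
  - by exists (y, m y); [apply/mapP; exists y | left].
  by exists (m y, m (m y)); [apply/mapP; exists (m y) | right; rewrite mK].
apply: (connect_invariant (P := mem alternating_cycle)) (mn_connected x) _.
  move=> u v /orP[]/andP[_ /eqP->] /cP ou; apply/cP.
    by rewrite mK; tauto.
  case: ou => ou; first by right; rewrite -o_p /p mK nK.
  by left; rewrite -[u]mK -/(p (m u)) o_p.
by apply/cP; left; rewrite -fconnect_orbit.
Qed.

Lemma alternating_cycle_uniq : uniq alternating_cycle.
Proof.
rewrite /alternating_cycle; have := orbit_uniq p x0; rewrite -/o.
have : {subset o <= o} by []; move: {1 3 4}o => s.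
elim: s => //= x s IHs so /andP[sx us].
have os y : y \in s -> y \in o by move=> sy; apply: so; rewrite inE sy orbT.
have ox : x \in o by apply: so; rewrite mem_head.
rewrite -/(ends _) inE negb_or eq_sym m_neq IHs //= andbT.
apply/andP; split; apply/negP=> /mem_ends[_ /mapP[y sy ->]] /= [].
- by move=> eq_x; rewrite eq_x sy in sx.
- by move=> eq_x; have := alternate_notin (os y sy); rewrite -eq_x ox.
- by move=> eq_y; have := alternate_notin ox; rewrite eq_y os.
by move=> /(inv_inj mK) eq_x; rewrite eq_x sy in sx.
Qed.

Let step : rel T := fun x y => y == if x \in o then m x else n x.

Lemma alternating_cycle_step : cycle step alternating_cycle.
Proof.
have path_step x s : {subset x :: s <= o} -> fpath p x s ->
    path step (m x) (rcons (ends [seq (y, m y) | y <- s]) (p (last x s))).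
  have step_m y : y \in o -> step (m y) (p y).
    by move=> oy; rewrite /step (negPf (alternate_notin oy)).
  elim: s x => [|y s IHs] x so /=; first by rewrite step_m ?so ?mem_head.
  case/andP=> /eqP pxy ys; rewrite -/(ends _).
  have oy : y \in o by rewrite so // !inE eqxx orbT.
  rewrite -{1}pxy step_m ?so ?mem_head //= {1}/step oy eqxx /=.
  by apply: IHs => // z sz; apply: so; rewrite inE sz orbT.
have := cycle_orbit p_inj x0; rewrite /alternating_cycle -/o.
have : {subset o <= o} by []; move: {1 3 4}o => [|x s] //= so.
rewrite rcons_path => /andP[xs /eqP last_s].
rewrite -/(ends _) {1}/step so ?mem_head // eqxx /=.
by rewrite -{2}last_s; apply: path_step.
Qed.

Lemma alternating_cycle_next x :
  next alternating_cycle x = if x \in o then m x else n x.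
Proof.
by apply/eqP; apply: (next_cycle alternating_cycle_step); apply: mem_alternating_cycle.
Qed.

(** Each edge is read off where the cycle leaves along it: [m] edges at their end in [o], [n] edges
    at their end outside [o]. *)
Lemma alternating_cycle_edges : cycle_edges alternating_cycle =
  [set [set x; m x] | x : T] :|: [set [set x; n x] | x : T].
Proof.
have in_c x (B : {set T}) : B = [set x; if x \in o then m x else n x] ->
    B \in cycle_edges alternating_cycle.
  move=> ->; rewrite -alternating_cycle_next.
  by apply: imset_f; apply: mem_alternating_cycle.
apply/eqP; rewrite eqEsubset; apply/andP; split; apply/subsetP=> B.
  case/imsetP=> x _ ->; rewrite alternating_cycle_next inE.
  by case: ifP => _; apply/orP; [left|right]; apply: imset_f.
rewrite inE => /orP[] /imsetP[x _ ->]; have [ox|ox] := boolP (x \in o).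
- by apply: (in_c x); rewrite ox.
- apply: (in_c (m x)).
  have /mem_ends[_ /mapP[y oy ->] /= [eq_x|eq_x]] := mem_alternating_cycle x.
    by rewrite eq_x oy in ox.
  by rewrite eq_x mK oy setUC.
- apply: (in_c (n x)); rewrite nK setUC -[in n x \in o](mK x) -/(p (m x)) o_p.
  by rewrite (negPf (alternate_notin ox)).
by apply: (in_c x); rewrite (negPf ox).
Qed.

End AlternatingCycle.

(** Disjointness of the blocks makes the partner of [x] unique, so choosing partners gives an
    involution. *)
Lemma pairing_involution (G : sgraph) (M : {set {set G}}) : pairing M ->
  exists2 m, pairing_on [set: G] m & M = [set [set x; m x] | x : G].
Proof.
case/and3P=> /subsetP Medges triv /eqP coverM.
have partner x : exists y, ([set x; y] \in M) && (y != x).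
  have : x \in cover M by rewrite coverM inE.
  case/bigcupP=> B MB; have /imsetP[[u v]] := Medges B MB.
  rewrite inE /= => uv eqB; rewrite eqB in MB *; rewrite !inE => /orP[]/eqP->.
    by exists v; rewrite MB eq_sym.
  by exists u; rewrite setUC MB.
pose m x := xchoose (partner x).
have Mm x : [set x; m x] \in M by case/andP: (xchooseP (partner x)).
have m_neq x : m x != x by case/andP: (xchooseP (partner x)).
have m_uniq x y : [set x; y] \in M -> y != x -> y = m x.
  move=> Mxy yx; have eq_m : [set x; y] = [set x; m x].
    rewrite -(def_pblock triv Mxy (set21 x y)).
    exact: def_pblock triv (Mm x) (set21 x (m x)).
  by have := set22 x y; rewrite eq_m !inE (negPf yx) => /eqP.
exists m.
  move=> x _; split=> //; apply/esym/m_uniq; last by rewrite eq_sym.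
  by rewrite setUC.
apply/setP=> B; apply/idP/imsetP => [MB|[x _ ->]]; last exact: Mm.
have /imsetP[[u v]] := Medges B MB; rewrite inE /= => uv eqB.
by exists u; rewrite // eqB -(m_uniq u v) // -?eqB // eq_sym.
Qed.

Lemma involution_perfect_matching (G : sgraph) (n : G -> G) :
    pairing_on [set: G] n -> (forall x, adj x (n x)) ->
  perfect_matching [set [set x; n x] | x : G].
Proof.
move=> nT adj_n; have block z (B : {set G}) : B \in [set [set x; n x] | x : G] -> z \in B ->
    B = [set z; n z].
  case/imsetP=> x _ ->; rewrite !inE => /orP[]/eqP-> //.
  by have [_ -> _] := nT x (in_setT x); rewrite setUC.
apply/and3P; split.
- by apply/subsetP=> _ /imsetP[x _ ->]; apply/imsetP; exists (x, n x); rewrite ?inE.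
- apply/trivIsetP=> A B NA NB; apply: contraR => /pred0Pn[z /andP[/= Az Bz]].
  by apply/eqP; apply: etrans (block z A NA Az) (esym (block z B NB Bz)).
apply/eqP/setP=> x; rewrite inE; apply/bigcupP.
by exists [set x; n x]; [apply: imset_f | rewrite set21].
Qed.

(** The bound excludes the doubled edge on two vertices and supplies a starting point for the
    cycle. *)
Lemma hamiltonian_on_pairing (G : sgraph) : 2 < #|G| ->
  hamiltonian_on (@adj G) [set: G] -> pairing_hamiltonian G.
Proof.
move=> G_gt2 [evG hamG]; rewrite cardsT in evG; split=> // M pairM.
have [m mT ->] := pairing_involution pairM.
have [n [nT gn conn]] := hamG m mT.
exists [set [set x; n x] | x : G].
  by apply: involution_perfect_matching => // x; apply: gn.
have /card_gt0P[x0 _] : 0 < #|G| by apply: leq_trans G_gt2.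
have conn0 x : connect (link [set: G] m [set: G] n) x0 x by apply: conn.
exists (alternating_cycle m n x0); last exact: alternating_cycle_edges.
have uc := alternating_cycle_uniq x0 mT nT.
have c_all := mem_alternating_cycle mT nT conn0.
split=> //.
  by rewrite -(card_uniqP uc) (eq_card (B := G)) // => x; rewrite c_all.
rewrite /ucycle uc andbT; apply: sub_cycle (alternating_cycle_step x0 mT nT).
move=> x y /eqP-> /=; case: ifP => _; rewrite eq_sym.
  by have [] := mT x (in_setT x).
by have [] := nT x (in_setT x).
Qed.

Theorem theorem3p5 (G : sgraph) (Gconn : connected G) :
  pairing_hamiltonian (iter (ml G + 3) prism G).
Proof.
(* After [addnC] the graph is, by conversion, the triple prism over the traceable graph [X]. *)
have [s sX] := traceable_ml Gconn; rewrite addnC; set X := iter (ml G) prism G in s sX.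
have [r] : exists r : G, true by case/andP: Gconn => /card_gt0P[r _]; exists r.
have [x0 _] := base_surj (ml G) r => _.
apply: hamiltonian_on_pairing; last exact: traceable_hamiltonian_on x0 s sX.
have X_gt0 : 0 < #|X| by apply/card_gt0P; exists x0.
by rewrite /= !card_prod card_bool -!mulnA; case: #|X| X_gt0 => // k _; rewrite mulSn.
Qed.
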